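(* Let $\Omega(B^\pm)=\Omega(B^+)\cup\Omega(B^-)$ be an Andreev billiard, and suppose $B^+$ is a polygon. The collision map $F_\pm:(B^\pm\times S^1)/\!\sim_\pm\ \to(B^\pm\times S^1)/\!\sim_\pm$ (where it is defined) preserves the measure $\cos\phi\,dr\,d\phi$ on the space $(B^\pm\times S^1)/\!\sim_\pm$.
   Context: Polygonal Andreev billiard: let $\Omega(B^+)$ be a polygonal billiard, i.e. a compact region in the plane whose boundary $B^+$ is a polygon. Let $A^+\subseteq B^+$ be a nonempty connected $C^1$ subset which is a vertical segment of $B^+$ and contains no singularities (corners) of the billiard flow. Let $\rho$ be the reflection of the plane through a line parallel to $A^+$ that does not meet the interior of $\Omega(B^+)$, and put $\Omega(B^-)=\rho(\Omega(B^+))$, $B^-=\rho(B^+)$, $A^-=\rho(A^+)$. The regions $\Omega(B^+)$ and $\Omega(B^-)$ are regarded as two copies of a billiard table, and are glued along $A^+$ and $A^-$ according to the relation $\sim_\pm$ below. Write $\Omega(B^\pm)=\Omega(B^+)\cup\Omega(B^-)$ and $B^\pm=B^+\cup B^-$; $A^+\cup A^-$ is called the Andreev subset. Relation $\sim_\pm$: directions are angles $\theta\in S^1$ measured from the positive horizontal axis, and at a boundary point $\mathbf{x}$, $r(\theta)$ denotes the reflection of $\theta$ through the tangent line at $\mathbf{x}$ (so for a vertical side $r(\theta)=\pi-\theta$). On $(\Omega(B^+)\cup\Omega(B^-))\times S^1$, $(\mathbf{x},\theta)\sim_\pm(\mathbf{y},\gamma)$ if and only if one of the following holds: (i) $\mathbf{x},\mathbf{y}\in\Omega(B^+)^\circ\cup\Omega(B^-)^\circ$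 and $(\mathbf{x},\theta)=(\mathbf{y},\gamma)$; (ii) $\mathbf{x},\mathbf{y}\in(B^+\cup B^-)\setminus(A^+\cup A^-)$, $\mathbf{x}=\mathbf{y}$, and $\theta=\gamma$ or $\theta=r(\gamma)$; (iii) $\mathbf{x},\mathbf{y}\in A^+\cup A^-$, and either $\mathbf{x}=\mathbf{y}$ and $\theta=\gamma$, or $\mathbf{x}=\rho(\mathbf{y})$ and $\theta=r(\gamma)+\pi$. A class over a boundary point is represented by a pair $(\mathbf{x},\theta)$ with $\theta$ inward pointing at $\mathbf{x}$. Flow: a point mass moves with unit speed in a straight line in its direction $\theta$ inside $\Omega(B^+)$ or $\Omega(B^-)$. On reaching a point of $B^\pm\setminus(A^+\cup A^-)$ with direction $\theta$ it continues with direction $r(\theta)$ (the law of reflection). On reaching a point $\mathbf{y}\in A^+$ (resp. $A^-$) with direction $\theta$ it continues in the other copy from $\rho(\mathbf{y})$ with direction $r(\theta)+\pi$. The flow is defined as long as the trajectory does not meet a corner. Collision map $F_\pm$: it sends the inward-pointing representative $(\mathbf{x},\theta)$, $\mathbf{x}\in B^\pm$, to the inward-pointing representative of the phase point at which the trajectory starting from $\mathbf{x}$ in direction $\theta$ next meets $B^\pm$; it is defined away from corners and other singularities of the flow. Coordinates: $r$ is the arc-length parameter on the sides of $B^+$ and of $B^-$ (the orientation of the parameterization of $B^-$ being opposite to that of $B^+$), and $\phi\in(-\pi/2,\pi/2)$ is the angle of the inward direction with the inward normal, i.e. $\phi=\frac{\pi}{2}-\psi$ where $\psi$ is the angle between the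 direction and the side. *)

(* Defs.v *)
From HB Require Import structures.
From mathcomp Require Import all_boot all_order all_algebra generic_quotient.
From mathcomp Require Import all_classical all_reals all_analysis.
From mathcomp Require Import measurable_realfun ring lra.
Set Implicit Arguments.
Unset Strict Implicit.
Unset Printing Implicit Defensive.
Import Order.TTheory GRing.Theory Num.Theory.
Import numFieldNormedType.Exports.
Local Open Scope classical_set_scope.
Local Open Scope ring_scope.
Local Open Scope quotient_scope.

(* The norm that mathcomp-analysis puts on R * R is the maximum norm, hence the
   Euclidean structure below. *)
Definition dotp {R : realType} (u v : R * R) : R := u.1 * v.1 + u.2 * v.2.

Definition enorm {R : realType} (u : R * R) : R := Num.sqrt (dotp u u).

(* A direction theta in S^1 is encoded as the unit vector
   (cos theta, sin theta), so that theta + pi is the opposite vector. *)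
Definition unit_circle {R : realType} : set (R * R) :=
  [set u | dotp u u = 1].

(* Reflection of directions through a line with unit tangent vector t. *)
Definition reflection {R : realType} (t u : R * R) : R * R :=
  (2 * dotp u t) *: t - u.

Definition mirror {R : realType} (m : R) (x : R * R) : R * R :=
  (2 * m - x.1, x.2).

Definition side_point {R : realType} {n : nat} (v : 'I_n -> R * R) (i : 'I_n)
    (t : R) : R * R :=
  v i + t *: (v (ordS i) - v i).

Definition polygon_line {R : realType} {n : nat} (v : 'I_n -> R * R) :
    set (R * R) :=
  [set x | exists i t, 0 <= t <= 1 /\ x = side_point v i t].

(* The closed polygonal line through the v i has no self-intersection; in
   particular all sides are nondegenerate. *)
Definition simple_polygon {R : realType} {n : nat} (v : 'I_n -> R * R) : Prop :=
  forall i j t t', 0 <= t < 1 -> 0 <= t' < 1 ->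
    side_point v i t = side_point v j t' -> i = j /\ t = t'.

Definition polygon_open_side {R : realType} {n : nat} (v : 'I_n -> R * R)
    (i : 'I_n) : set (R * R) :=
  [set x | exists2 t, 0 < t < 1 & x = side_point v i t].

(* region is Omega(B^+), plus_vertex lists the corners of B^+, andreev is A^+
   and axis is the abscissa of the vertical line of the reflection rho. *)
Record andreevBilliard (R : realType) := AndreevBilliard {
  nsides : nat;
  plus_vertex : 'I_nsides -> R * R;
  nsides_ge3 : (3 <= nsides)%N;
  plus_vertex_simple : simple_polygon plus_vertex;
  region : set (R * R);
  region_compact : compact region;
  region_regular : closure region° = region;
  region_connected : connected region°;
  region_boundary : region `\` region° = polygon_line plus_vertex;
  andreev : set (R * R);
  andreev_nonempty : andreev !=set0;
  andreev_connected : connected andreev;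
  andreev_vertical : exists2 i,
    (plus_vertex i).1 = (plus_vertex (ordS i)).1 &
    andreev `<=` polygon_open_side plus_vertex i;
  axis : R;
  axis_exterior : forall x, region° x -> x.1 != axis
}.

Arguments plus_vertex {R} a _.

Section AndreevBilliard.
Context {R : realType} (T : andreevBilliard R).

(* The two copies of the table are indexed by bool (true for +) and kept
   disjoint even when the axis of rho touches Omega(B^+). *)
Definition table (s : bool) : set (R * R) :=
  if s then region T else mirror (axis T) @` region T.

Definition vertex (s : bool) (i : 'I_(nsides T)) : R * R :=
  if s then plus_vertex T i else mirror (axis T) (plus_vertex T i).

Definition andreev_set (s : bool) : set (R * R) :=
  if s then andreev T else mirror (axis T) @` andreev T.

Definition boundary (s : bool) : set (R * R) := polygon_line (vertex s).

Definition open_side (s : bool) (i : 'I_(nsides T)) : set (R * R) :=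
  polygon_open_side (vertex s) i.

Definition noncorner (s : bool) : set (R * R) :=
  [set x | exists i, open_side s i x].

Definition side_length (s : bool) (i : 'I_(nsides T)) : R :=
  enorm (vertex s (ordS i) - vertex s i).

Definition tangent (s : bool) (i : 'I_(nsides T)) : R * R :=
  (side_length s i)^-1 *: (vertex s (ordS i) - vertex s i).

Definition location : Type := (bool * (R * R))%type.

Definition rho (x : location) : location := (~~ x.1, mirror (axis T) x.2).

Definition state : Type := (location * (R * R))%type.

Definition on (D : bool -> set (R * R)) : set location :=
  [set x | D x.1 x.2].

(* u' = r(u) at the boundary point x; no u' qualifies when x is a corner. *)
Definition reflects (x : location) (u u' : R * R) : Prop :=
  exists2 i, open_side x.1 i x.2 & u' = reflection (tangent x.1 i) u.

Definition andreev_rel (p q : state) : Prop :=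
  [\/ [/\ on (fun s => (table s)°) p.1, on (fun s => (table s)°) q.1 & p = q],
      [/\ on (fun s => boundary s `\` andreev_set s) p.1,
          on (fun s => boundary s `\` andreev_set s) q.1,
          p.1 = q.1 &
          p.2 = q.2 \/ reflects q.1 q.2 p.2] |
      [/\ on andreev_set p.1, on andreev_set q.1 &
          (p.1 = q.1 /\ p.2 = q.2) \/
          (p.1 = rho q.1 /\ exists2 w, reflects q.1 q.2 w & p.2 = - w)]].

Definition boundary_state : set state :=
  [set p | on boundary p.1 /\ unit_circle p.2].

End AndreevBilliard.

Section AndreevEquivalence.
Context {R : realType} (T : andreevBilliard R).
Implicit Types (s : bool) (i j : 'I_(nsides T)) (x : R * R).

Lemma mirrorK (m : R) : involutive (mirror m).
Proof. by move=> [a b]; rewrite /mirror /=; congr pair; ring. Qed.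

Lemma rhoK : involutive (rho T).
Proof. by move=> [s x]; rewrite /rho /= negbK mirrorK. Qed.

Lemma vertexN s i : vertex (~~ s) i = mirror (axis T) (vertex s i).
Proof. by case: s => //=; rewrite mirrorK. Qed.

Lemma side_pointN s i t :
  side_point (vertex (~~ s)) i t = mirror (axis T) (side_point (vertex s) i t).
Proof.
rewrite /side_point !vertexN /mirror.
case: (vertex s i) (vertex s (ordS i)) => a b [c d].
by congr pair => /=; rewrite /GRing.scale /=; ring.
Qed.

Lemma vertex_simple s : simple_polygon (vertex (T := T) s).
Proof.
have H : simple_polygon (plus_vertex T) by case: T.
case: s; first exact: H.
move=> i j t t' ht ht'; rewrite (side_pointN true) (side_pointN true).
by move=> /(inv_inj (mirrorK _)); exact: H.
Qed.

Lemma open_side_inj s i j x : open_side s i x -> open_side s j x -> i = j.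
Proof.
move=> [t /andP[t0 t1] ->] [t' /andP[t'0 t'1]] e.
by have [] := @vertex_simple s i j t t' _ _ e; rewrite ?(ltW t0) ?(ltW t'0).
Qed.

Lemma open_sideN s i x :
  open_side s i x -> open_side (~~ s) i (mirror (axis T) x).
Proof. by move=> [t ht ->]; exists t => //; rewrite side_pointN. Qed.

Lemma open_side_boundary s i x : open_side s i x -> boundary T s x.
Proof. by move=> [t /andP[/ltW ? /ltW ?] ->]; exists i, t; split=> //; apply/andP. Qed.

Lemma side_vector_neq0 s i : vertex s (ordS i) - vertex s i != 0.
Proof.
apply/eqP => e.
have [] // := @vertex_simple s i i 0 2^-1; try by apply/andP; split; lra.
  by rewrite /side_point e !scaler0.
by move=> _; lra.
Qed.

Lemma tangent_unit s i : dotp (tangent s i) (tangent s i) = 1.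
Proof.
have := side_vector_neq0 s i; rewrite /tangent /side_length.
case: (_ - _) => a b ab0.
have d0 : 0 < dotp (a, b) (a, b).
  rewrite lt_neqAle; apply/andP; split; last by rewrite addr_ge0 // -expr2 sqr_ge0.
  apply: contra ab0; rewrite eq_sym /dotp /= -!expr2 paddr_eq0 ?sqr_ge0 //.
  by rewrite !sqrf_eq0 => /andP[/eqP -> /eqP ->].
have -> : dotp ((enorm (a, b))^-1 *: (a, b)) ((enorm (a, b))^-1 *: (a, b)) =
          ((enorm (a, b)) ^+ 2)^-1 * dotp (a, b) (a, b).
  by rewrite /dotp -exprVn /= /GRing.scale /=; ring.
by rewrite /enorm sqr_sqrtr ?mulVf ?gt_eqF // ltW.
Qed.

Lemma reflectionK (t : R * R) : dotp t t = 1 -> involutive (reflection t).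
Proof.
move=> t1 u.
have -> : reflection t (reflection t u) =
          u + (4 * dotp u t * (dotp t t - 1)) *: t.
  case: t u {t1} => a b [c d].
  by rewrite /reflection /dotp /=; congr pair; rewrite /= /GRing.scale /=; ring.
by rewrite t1 subrr mulr0 scale0r addr0.
Qed.

Lemma reflectionN (t u : R * R) : reflection t (- u) = - reflection t u.
Proof.
case: t u => a b [c d].
by rewrite /reflection /dotp /=; congr pair; rewrite /= /GRing.scale /=; ring.
Qed.

Lemma andreev_side : exists i,
  (forall s, andreev_set T s `<=` open_side s i) /\
  (forall s u, reflection (tangent s i) u = reflection (tangent (~~ s) i) u).
Proof.
have [i vi Ai] := andreev_vertical T; exists i; split.
  case => /=; first exact: Ai.
  by move=> _ [x /Ai Ax <-]; exact: (@open_sideN true).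
suff H s : tangent s i = tangent (~~ s) i by move=> s u; rewrite (H s).
have D r : vertex r (ordS i) - vertex r i =
    plus_vertex T (ordS i) - plus_vertex T i.
  case: r => //=; rewrite /mirror.
  case: (plus_vertex T i) (plus_vertex T (ordS i)) vi => a b [c d] /= ->.
  by congr pair => /=; ring.
by rewrite /tangent /side_length !D.
Qed.

Lemma andreev_setN s x :
  andreev_set T s x -> andreev_set T (~~ s) (mirror (axis T) x).
Proof.
case: s => /=; first by move=> Ax; exists x.
by move=> [y Ay <-]; rewrite mirrorK.
Qed.

Lemma andreev_rel_refl (p : state) : boundary_state T p -> andreev_rel T p p.
Proof.
move=> [Bp _]; have [Ap|Ap] := pselect (on (andreev_set T) p.1).
  by apply: Or33; split => //; left.
by apply: Or32; split => //; left.
Qed.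

Lemma andreev_rel_sym (p q : state) : andreev_rel T p q -> andreev_rel T q p.
Proof.
case=> [[ip iq ->]|[bp bq e h]|[ap aq h]].
- exact: Or31.
- apply: Or32; split => //; case: h => [->|[i xi ->]]; first by left.
  right; exists i; rewrite e //.
  by rewrite reflectionK //; exact: tangent_unit.
- apply: Or33; split => //; case: h => [[-> ->]|[e [w [j xj ->] ->]]].
    by left.
  right; split; first by rewrite e rhoK.
  have [i [Ai ri]] := andreev_side.
  have ? : j = i by exact: open_side_inj xj (Ai _ _ aq).
  subst j; exists (- q.2); last by rewrite opprK.
  exists i; first by rewrite e; exact: open_sideN.
  rewrite e /= -ri reflectionN reflectionK //; exact: tangent_unit.
Qed.

Lemma andreev_rel_trans (q p r : state) :
  boundary_state T q -> andreev_rel T p q -> andreev_rel T q r ->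
  andreev_rel T p r.
Proof.
move=> [bq _]; have [i [Ai ri]] := andreev_side.
case=> [[ip iq ->] //|[bp bq' e h]|[ap aq h]].
- case=> [[iq ir <-]|[_ br e' h']|[aq ar h']].
  + by apply: Or32; split.
  + apply: Or32; split => //; first by rewrite e.
    case: h => [->|[j xj ->]] //.
    case: h' => [<-|[k xk ->]]; first by right; exists j; rewrite -?e'.
    left; move: xj; rewrite e' => xj.
    rewrite (open_side_inj xj xk) reflectionK //; exact: tangent_unit.
  + by case: bq'.
- case=> [[iq ir <-]|[[_ nq] br e' h']|[_ ar h']]; first by apply: Or33; split.
    by [].
  apply: Or33; split => //.
  case: h => [[-> ->] //|[e [w [j xj ->] ->]]].
  case: h' => [[<- <-]|[e' [w' [k xk ->] eq2]]].
    by right; split => //; exists (reflection (tangent q.1.1 j) q.2) => //; exists j.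
  left; split; first by rewrite e e' rhoK.
  have ? : j = i by exact: open_side_inj xj (Ai _ _ aq).
  have ? : k = i by exact: open_side_inj xk (Ai _ _ ar).
  subst j k; rewrite eq2 reflectionN opprK e' /= -ri reflectionK //.
  exact: tangent_unit.
Qed.

Definition boundary_rel (p q : boundary_state T) : bool :=
  `[< andreev_rel T (val p) (val q) >].

Lemma boundary_rel_refl : reflexive boundary_rel.
Proof. by move=> p; apply/asboolP/andreev_rel_refl/set_mem/(valP p). Qed.

Lemma boundary_rel_sym : symmetric boundary_rel.
Proof. by move=> p q; apply/asboolP/asboolP; exact: andreev_rel_sym. Qed.

Lemma boundary_rel_trans : transitive boundary_rel.
Proof.
move=> q p r /asboolP pq /asboolP qr; apply/asboolP.
by apply: andreev_rel_trans pq qr; apply/set_mem/(valP q).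
Qed.

Canonical boundary_equiv :=
  EquivRel boundary_rel boundary_rel_refl boundary_rel_sym boundary_rel_trans.

(* (B^{+-} x S^1) / ~, where boundary_state is B^{+-} x S^1.  Clause (i) of the
   relation, about interior points, is void there. *)
Definition collision_space : Type := {eq_quot boundary_equiv}.
HB.instance Definition _ := EqQuotient.on collision_space.
HB.instance Definition _ := Choice.on collision_space.

End AndreevEquivalence.

Section CollisionMap.
Context {R : realType} (T : andreevBilliard R).
Implicit Types (s : bool) (i : 'I_(nsides T)).

Local Notation class := (\pi_(collision_space T)).

Definition inward s (x u : R * R) : Prop :=
  exists2 e, 0 < e & forall t, 0 < t < e -> (table T s)° (x + t *: u).

(* p and q are the endpoints of one free flight: starting inward from a point
   other than a corner, the trajectory of p stays off the boundary before time
   t, and q is its state on arrival at time t, again not at a corner.  What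
   the flow does upon arrival (specular reflection, or passage to the other
   copy) is the choice of the inward-pointing representative of the class
   of q. *)
Definition free_flight (p q : boundary_state T) : Prop :=
  let: ((s, x), u) := val p in
  [/\ noncorner T s x, inward s x u &
      exists t, [/\ 0 < t,
        forall t', 0 < t' < t -> ~ boundary T s (x + t' *: u),
        noncorner T s (x + t *: u) &
        val q = ((s, x + t *: u), u)]].

Definition collides (c c' : collision_space T) : Prop :=
  exists p q, [/\ c = class p, c' = class q & free_flight p q].

Definition collision_dom : set (collision_space T) :=
  [set c | exists c', collides c c'].

(* A total function that is only meaningful on collision_dom.  There the class
   c' is unique, since a class has at most one inward-pointing representative
   over a point other than a corner, and its first arrival is unique. *)
Definition collision_map (c : collision_space T) : collision_space T :=
  xget c [set c' | collides c c'].

(* The inward unit normal of a side. *)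
Definition normal s i : R * R :=
  xget 0 [set nu | [/\ unit_circle nu, dotp nu (tangent s i) = 0 &
                       forall x, open_side s i x -> inward s x nu]].

Lemma boundary_state_inhabited : exists p : state, p \in boundary_state T.
Proof.
exists ((true, plus_vertex T (Ordinal (ltn_trans (isT : 0 < 2)%N (nsides_ge3 T)))),
  (1, 0)); apply/mem_set; split.
  exists (Ordinal (ltn_trans (isT : 0 < 2)%N (nsides_ge3 T))), 0.
  by rewrite lexx ler01 /side_point scale0r addr0.
by rewrite /unit_circle /dotp /= mulr0 mulr1 addr0.
Qed.

(* Only serves as the default value of insubd below; every point of coord_dom
   does yield a state. *)
Definition base_state : boundary_state T :=
  let: exist p hp := cid boundary_state_inhabited in SigSub hp.

HB.instance Definition _ := isPointed.Build (collision_space T)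
  (class base_state).

Definition coord_dom s i : set (R * R) :=
  `]0, side_length s i[ `*` `](- (pi / 2)), (pi / 2)[.

(* The class with coordinates z = (r, phi) on the side i of the copy s.  Since
   rho reverses the orientation, r runs along the two copies with opposite
   orientations. *)
Definition of_coord s i (z : R * R) : collision_space T :=
  class (insubd base_state
    ((s, vertex s i + z.1 *: tangent s i),
     sin z.2 *: tangent s i + cos z.2 *: normal s i)).

Definition coord_preimage s i (E : set (collision_space T)) : set (R * R) :=
  coord_dom s i `&` of_coord s i @^-1` E.

(* The final sigma-algebra of the coordinates (r, phi). *)
Definition collision_measurable : set (set (collision_space T)) :=
  [set E | forall s i, measurable (coord_preimage s i E)].

Lemma measurable_coord_dom s i : measurable (coord_dom s i).
Proof. by apply: measurableX. Qed.

Lemma collision_measurable0 : collision_measurable set0.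
Proof. by move=> s i; rewrite /coord_preimage preimage_set0 setI0. Qed.

Lemma collision_measurableC E :
  collision_measurable E -> collision_measurable (~` E).
Proof.
move=> mE s i; rewrite /coord_preimage preimage_setC -setDE.
have -> : forall A B : set (R * R), A `\` B = A `\` (A `&` B).
  by move=> A B; rewrite setDIr setDv set0U.
by apply: measurableD; [exact: measurable_coord_dom|exact: mE].
Qed.

Lemma collision_measurable_bigcup (F : (set (collision_space T))^nat) :
  (forall k, collision_measurable (F k)) ->
  collision_measurable (\bigcup_k F k).
Proof.
move=> mF s i; rewrite /coord_preimage preimage_bigcup setI_bigcupr.
by apply: bigcupT_measurable => k; exact: mF.
Qed.

HB.instance Definition _ := @isMeasurable.Build default_measure_display
  (collision_space T) collision_measurable collision_measurable0
  collision_measurableC collision_measurable_bigcup.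

Local Open Scope ereal_scope.

(* cos(phi) dr dphi *)
Definition cosphi_measure (E : set (collision_space T)) : \bar R :=
  \sum_(s : bool) \sum_(i < nsides T)
    \int[lebesgue_measure \x lebesgue_measure]_(z in coord_preimage s i E)
      (cos z.2)%:E.

Let cosphi_measure0 : cosphi_measure set0 = 0.
Proof.
rewrite /cosphi_measure big1// => s _; rewrite big1// => i _.
by rewrite /coord_preimage preimage_set0 setI0 integral_set0.
Qed.

Let cos_ge0 s i (z : R * R) : coord_dom s i z -> 0 <= (cos z.2)%:E.
Proof.
move=> [_ /=]; rewrite in_itv /= => /andP[a b].
by rewrite lee_fin; apply: cos_ge0_pihalf; rewrite !ltW.
Qed.

Let cosphi_measure_ge0 E : 0 <= cosphi_measure E.
Proof.
apply: sume_ge0 => s _; apply: sume_ge0 => i _; apply: integral_ge0 => z [zd _].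
exact: cos_ge0 zd.
Qed.

Let cosphi_measure_sigma_additive : semi_sigma_additive cosphi_measure.
Proof.
move=> F mF tF mUF.
have -> : cosphi_measure (\bigcup_k F k) = \sum_(k <oo) cosphi_measure (F k).
  rewrite /cosphi_measure nneseries_sum; last first.
    move=> s k _; apply: sume_ge0 => i _; apply: integral_ge0 => z [zd _].
    exact: cos_ge0 zd.
  apply: eq_bigr => s _; rewrite nneseries_sum; last first.
    by move=> i k _; apply: integral_ge0 => z [zd _]; exact: cos_ge0 zd.
  apply: eq_bigr => i _.
  rewrite /coord_preimage preimage_bigcup setI_bigcupr.
  apply: ge0_integral_bigcup.
  - by move=> k; exact: mF.
  - apply/measurable_EFinP; apply: (measurableT_comp (f := cos)).
      by apply: continuous_measurable_fun; exact: continuous_cos.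
    apply: (measurable_funS measurableT) => //; exact: measurable_snd.
  - by move=> z [k _ [zd _]]; exact: cos_ge0 zd.
  - apply/trivIsetP => j k _ _ jk; move/trivIsetP : tF => /(_ j k I I jk) jk0.
    by rewrite setIACA setIid -preimage_setI jk0 preimage_set0 setI0.
by apply: is_cvg_nneseries => k _ _; exact: cosphi_measure_ge0.
Qed.

HB.instance Definition _ := isMeasure.Build _ _ _ cosphi_measure
  cosphi_measure0 cosphi_measure_ge0 cosphi_measure_sigma_additive.

End CollisionMap.

Arguments collision_dom {R} T.
Arguments collision_map {R} T c.
Arguments cosphi_measure {R} T E.

(* Main.v *)
(* The proof uses that cos(phi) dr dphi is, on each side, the measure dh dtheta
   on the lines through that side, theta being the direction of the line and h
   its signed distance to the origin; a free flight does not change the line.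
   In coordinates, a flight between two given sides maps phi to e phi + b with
   e = 1 or -1 and, for fixed phi, maps r affinely with slope
   +- cos(phi) / cos(phi'), so that Fubini's theorem and the affine invariance
   of the Lebesgue measure suffice.  Time reversal exchanges the domain and the
   image of a flight, hence the image too misses only lines through corners,
   which are finitely many for each phi and form a null set.  The passage to
   the other copy replaces phi by - phi, which preserves the measure. *)
From HB Require Import structures.
Require Import Defs.
From mathcomp Require Import all_boot all_order all_algebra generic_quotient.
From mathcomp Require Import all_classical all_reals all_analysis.
From mathcomp Require Import measurable_realfun ring lra.
Set Implicit Arguments.
Unset Strict Implicit.
Unset Printing Implicit Defensive.
Import Order.TTheory GRing.Theory Num.Theory.
Import numFieldNormedType.Exports.
Local Open Scope classical_set_scope.
Local Open Scope ring_scope.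

(** The table is only known as a regular compact set whose topological boundary is the polygonal
    line. The slope +- cos(phi) / cos(phi') comes from computing the signed distance h of the common
    line at both ends of a flight: h varies by +- cos(phi) per unit length along the side of
    departure and by +- cos(phi') along the side of arrival. Which pairs of boundary points see each
    other is not given by a formula, so measurability of flights rests on a compactness argument for
    visibility, and measurability of their images on time reversal. The Andreev set carries mass
    from one copy to the other, hence the final balance is drawn up over both copies together. *)

(** * Lebesgue measure under affine maps, and slicing at fixed angle *)

Section LebesgueAffine.
Context {R : realType}.
Local Notation mu := (@lebesgue_measure R).
Local Open Scope ereal_scope.

(** The scaled pushforward agrees with the Lebesgue measure on the intervals []c, d]], which
    determine it; for positive [a] their preimages are intervals of the same kind. *)
Lemma lebesgue_measure_affine_gt0 (a b : R) (S : set R) :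
  (0 < a)%R -> measurable S ->
  mu S = a%:E * mu ((fun r => a * r + b)%R @^-1` S).
Proof.
move=> a0 mS; pose f (r : measurableTypeR R) : measurableTypeR R := (a * r + b)%R.
have mf : measurable_fun setT f by apply: measurable_funD => //; exact: mulrl_measurable.
pose k : {nonneg R} := NngNum (ltW a0).
pose nu := mscale k (pushforward mu f).
rewrite (_ : _ * _ = nu mf S) //.
apply: (@lebesgue_measure_unique _ (nu mf)) => // X [[c d] /= _ <-].
rewrite /nu/= /mscale/= /pushforward.
have -> : f @^-1` `]c, d] = `](a^-1 * (c - b))%R, (a^-1 * (d - b))%R]%classic.
  apply/seteqP; split => r /=; rewrite /f !in_itv /= ltr_pdivrMl// ler_pdivlMl//.
    by move=> /andP[? ?]; apply/andP; split; lra.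
  by move=> /andP[? ?]; apply/andP; split; lra.
rewrite !lebesgue_measure_itv /= !lte_fin ltr_pM2l ?invr_gt0// ltrD2r.
case: ifPn => _; last by rewrite mule0.
by rewrite -EFinD -EFinM; congr EFin; field; rewrite gt_eqF.
Qed.

(** A negative slope would turn the half-open intervals around, so this case is reduced to the
    positive one by the invariance of the measure under r -> - r. *)
Lemma lebesgue_measure_affine (a b : R) (S : set R) :
  a != 0%R -> measurable S ->
  mu S = `|a|%:E * mu ((fun r => a * r + b)%R @^-1` S).
Proof.
rewrite neq_lt => /orP[a0|a0] mS; last first.
  by rewrite gtr0_norm//; exact: lebesgue_measure_affine_gt0.
have mT : measurable ((fun r : R => - r)%R @^-1` S).
  by rewrite -[X in measurable X]setTI; exact: oppr_measurable.
rewrite ltr0_norm// -lebesgue_measureN//.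
rewrite /pushforward (@lebesgue_measure_affine_gt0 (- a) (- b))// ?oppr_gt0//.
congr (_ * mu _); apply/funext => r /=; congr S; ring.
Qed.

Lemma ge0_integral_affine_unit (e b : R) (h : R -> \bar R) :
  (`|e| = 1)%R -> measurable_fun setT h -> (forall x, 0 <= h x) ->
  \int[mu]_x h x = \int[mu]_x h (e * x + b)%R.
Proof.
move=> e1 mh h0; pose f (r : measurableTypeR R) : measurableTypeR R := (e * r + b)%R.
have mf : measurable_fun setT f by apply: measurable_funD => //; exact: mulrl_measurable.
rewrite -[RHS](@ge0_integral_pushforward _ _ _ _ R f mf mu setT h)//.
apply: eq_measure_integral => A mA _ /=; rewrite /pushforward.
rewrite (@lebesgue_measure_affine e b A) ?e1 ?mul1e//.
by rewrite -normr_eq0 e1 oner_eq0.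
Qed.

Lemma cos_measurable : measurable_fun setT (@cos R).
Proof. by apply: continuous_measurable_fun; exact: continuous_cos. Qed.

Lemma integral_cos_ysection (P : set (R * R)) : measurable P ->
  (forall z, P z -> - (pi / 2) <= z.2 <= pi / 2)%R ->
  \int[mu \x mu]_(z in P) (cos z.2)%:E =
  \int[mu]_y ((cos y)%:E * mu (ysection P y)).
Proof.
move=> mP P0.
rewrite integral_mkcond fubini_tonelli2; last 2 first.
- apply/(measurable_restrictT _ mP); apply/measurable_EFinP.
  by apply: measurable_funTS; apply: measurableT_comp; first exact: cos_measurable.
- move=> z; rewrite patchE; case: ifPn => // /set_mem Pz.
  by rewrite lee_fin; apply: cos_ge0_pihalf; exact: P0.
apply: eq_integral => y _; rewrite /fubini_G.
rewrite -(@integral_cst _ _ _ mu _ (measurable_ysection y mP)) [RHS]integral_mkcond.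
by apply: eq_integral => x _; rewrite !patchE mem_ysection.
Qed.

(** On the slice at angle [y] the map r -> r' has slope of absolute value cos y / cos (e y + b),
    which the density cancels exactly; the angle map has slope [e] of absolute value 1. The
    correspondence is given as an equation between [r] and [r'] rather than as a function, which is
    how flights provide it. *)
Lemma skew_affine_invariance (P Q : set (R * R)) (e b s : R) (w : R -> R) :
  measurable P -> measurable Q ->
  (forall z, P z -> - (pi / 2) < z.2 < pi / 2)%R ->
  (forall z, Q z -> - (pi / 2) < z.2 < pi / 2)%R ->
  `|e|%R = 1%R -> `|s|%R = 1%R ->
  (forall r y, P (r, y) -> - (pi / 2) < e * y + b < pi / 2)%R ->
  (forall r y, Q (r, e * y + b)%R -> - (pi / 2) < y < pi / 2)%R ->
  (forall r r' y : R, - (pi / 2) < y < pi / 2 -> - (pi / 2) < e * y + b < pi / 2 ->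
     cos (e * y + b) * r' = s * cos y * r + w y ->
     P (r, y) <-> Q (r', e * y + b))%R ->
  \int[mu \x mu]_(z in P) (cos z.2)%:E = \int[mu \x mu]_(z in Q) (cos z.2)%:E.
Proof.
move=> mP mQ P0 Q0 e1 s1 Pe Qe PQ.
rewrite (integral_cos_ysection mP) ?(integral_cos_ysection mQ); last 2 first.
- by move=> z /Q0 /andP[? ?]; rewrite !ltW.
- by move=> z /P0 /andP[? ?]; rewrite !ltW.
rewrite [RHS](@ge0_integral_affine_unit e b _ e1); last 2 first.
- apply: emeasurable_funM; first by apply/measurable_EFinP; exact: cos_measurable.
  exact: measurable_fun_ysection.
- move=> y; have [Qy|/set0P[x]] := eqVneq (ysection Q y) set0.
    by rewrite Qy measure0 mule0.
  rewrite ysectionE /= => /Q0 /= /andP[? ?].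
  by rewrite mule_ge0// lee_fin; apply: cos_ge0_pihalf; rewrite !ltW.
apply: eq_integral => y _.
have [/andP[y1 y2]|yN] := boolP (- (pi / 2) < y < pi / 2)%R; last first.
  have -> : ysection P y = set0.
    by rewrite -subset0 => r; rewrite ysectionE /= => /P0; apply/negP.
  have -> : ysection Q (e * y + b)%R = set0.
    by rewrite -subset0 => r; rewrite ysectionE /= => /Qe; apply/negP.
  by rewrite measure0 !mule0.
have [/andP[y'1 y'2]|y'N] := boolP (- (pi / 2) < e * y + b < pi / 2)%R; last first.
  have -> : ysection P y = set0.
    by rewrite -subset0 => r; rewrite ysectionE /= => /Pe; apply/negP.
  have -> : ysection Q (e * y + b)%R = set0.
    by rewrite -subset0 => r; rewrite ysectionE /= => /Q0; apply/negP.
  by rewrite measure0 !mule0.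
have c0 : (0 < cos y)%R by apply: cos_gt0_pihalf; rewrite y1.
have c'0 : (0 < cos (e * y + b))%R by apply: cos_gt0_pihalf; rewrite y'1.
have s0 : s != 0%R by rewrite -normr_eq0 s1 oner_eq0.
have -> : ysection P y = (fun r => s * cos y / cos (e * y + b) * r +
    w y / cos (e * y + b))%R @^-1` ysection Q (e * y + b)%R.
  apply/seteqP; split => r; rewrite !ysectionE /= => H.
    apply/(PQ r); rewrite ?y1 ?y'1//; field; exact: lt0r_neq0.
  apply/(PQ _ _ _ _ _ _).2; last exact: H; rewrite ?y1 ?y'1//; field; exact: lt0r_neq0.
have mQs := measurable_ysection (e * y + b)%R mQ.
rewrite [in RHS](@lebesgue_measure_affine (s * cos y / cos (e * y + b))%R
  (w y / cos (e * y + b))%R _ _ mQs); last first.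
  by apply: mulf_neq0; [apply: mulf_neq0 => //|apply: invr_neq0]; exact: lt0r_neq0.
rewrite muleA -EFinM; congr (_%:E * _).
rewrite !normrM normfV s1 !gtr0_norm//; field; exact: lt0r_neq0.
Qed.

(** Serves to discard the phase points whose trajectory runs into a corner. *)
Lemma integral_cos_finite_ysection (P : set (R * R)) : measurable P ->
  (forall z, P z -> - (pi / 2) <= z.2 <= pi / 2)%R ->
  (forall y, finite_set (ysection P y)) ->
  \int[mu \x mu]_(z in P) (cos z.2)%:E = 0.
Proof.
move=> mP P0 fP; rewrite integral_cos_ysection//.
apply: integral0_eq => y _.
by rewrite countable_lebesgue_measure0 ?mule0//; exact: finite_set_countable.
Qed.

End LebesgueAffine.

(** * Open sets of the plane, and the mirror as a homeomorphism *)

(** An open set is the countable union of the rational open rectangles that it contains, and these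
    belong to the product sigma-algebra. *)
Lemma open_measurable_prod {R : realType} (A : set (R * R)) : open A -> measurable A.
Proof.
move=> oA.
pose B (a b c d : rat) : set (R * R) :=
  `]ratr a, ratr b[%classic `*` `]ratr c, ratr d[%classic.
have -> : A = \bigcup_a \bigcup_b \bigcup_c \bigcup_d
    (if `[< B a b c d `<=` A >] then B a b c d else set0).
  apply/seteqP; split => [[x y] Axy|z [a _ [b _ [c _ [d _]]]]]; last first.
    by case: asboolP => // + Bz; apply.
  have /nbhs_ballP[e /= e0 eA] : nbhs (x, y) A by apply: open_nbhs_nbhs.
  have [a] : exists q, ratr q \in `]x - e, x[ by apply: rat_in_itvoo; rewrite ltrBlDr ltrDl.
  have [b] : exists q, ratr q \in `]x, x + e[ by apply: rat_in_itvoo; rewrite ltrDl.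
  have [c] : exists q, ratr q \in `]y - e, y[ by apply: rat_in_itvoo; rewrite ltrBlDr ltrDl.
  have [d] : exists q, ratr q \in `]y, y + e[ by apply: rat_in_itvoo; rewrite ltrDl.
  rewrite !in_itv /= => /andP[d1 d2] /andP[c1 c2] /andP[b1 b2] /andP[a1 a2].
  exists a => //; exists b => //; exists c => //; exists d => //.
  case: asboolP => [_|[]]; first by split; rewrite /= in_itv /=; apply/andP.
  move=> [x' y'] [/=]; rewrite !in_itv /= => /andP[x1 x2] /andP[y1 y2].
  by apply: eA; split; rewrite /ball /= ltr_norml; apply/andP; split; lra.
apply: bigcupT_measurable_rat => a; apply: bigcupT_measurable_rat => b.
apply: bigcupT_measurable_rat => c; apply: bigcupT_measurable_rat => d.
by case: ifPn => // _; exact: measurableX.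
Qed.

Section Topology.
Context {R : realType}.
Implicit Types (x y z u : R * R).

Definition cross (u w : R * R) : R := u.1 * w.2 - u.2 * w.1.

Definition rot u : R * R := (- u.2, u.1).

Lemma affine_form_continuous (a b c : R) :
  continuous (fun x => a * x.1 + b * x.2 + c).
Proof.
move=> x; apply: cvgD; last exact: cvg_cst.
by apply: cvgD; apply: cvgM; [exact: cvg_cst|exact: cvg_fst|exact: cvg_cst|exact: cvg_snd].
Qed.

Lemma pair_continuous (U : topologicalType) (f g : U -> R) :
  continuous f -> continuous g -> continuous (fun p : U => (f p, g p)).
Proof. by move=> cf cg p; apply: (cvg_pair (cf p) (cg p)). Qed.

Lemma line_continuous x u : continuous (fun t : R => x + t *: u).
Proof.
move=> t; apply: cvgD; first exact: cvg_cst.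
by apply: cvgZr_tmp; exact: cvg_id.
Qed.

Lemma mirror_continuous (m : R) : continuous (mirror m).
Proof.
apply: pair_continuous => x; last exact: cvg_snd.
by apply: cvgB; [exact: cvg_cst|exact: cvg_fst].
Qed.

Lemma mirror_image (m : R) (A : set (R * R)) : mirror m @` A = mirror m @^-1` A.
Proof.
apply/seteqP; split => [_ [x Ax <-]|x Ax] /=; first by rewrite mirrorK.
by exists (mirror m x) => //; rewrite mirrorK.
Qed.

Lemma interior_mirror (m : R) (A : set (R * R)) :
  (mirror m @^-1` A)° = mirror m @^-1` A°.
Proof.
have sub (B : set (R * R)) : mirror m @^-1` B° `<=` (mirror m @^-1` B)°.
  by move=> x; exact: mirror_continuous.
apply/seteqP; split; last exact: sub.
move=> x Ax /=; have := @sub (mirror m @^-1` A) (mirror m x).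
rewrite /= mirrorK => /(_ Ax); rewrite -comp_preimage.
by rewrite (_ : _ \o _ = id) //; apply/funext => y; exact: mirrorK.
Qed.

Lemma closure_mirror (m : R) (A : set (R * R)) :
  closure (mirror m @^-1` A) = mirror m @^-1` closure A.
Proof.
apply: setC_inj; rewrite -interiorC.
have -> : ~` (mirror m @^-1` closure A) = mirror m @^-1` (~` A)° by rewrite interiorC.
by rewrite -interior_mirror.
Qed.

End Topology.

(** * Global topology of the two copies of the table *)

Section Table.
Context {R : realType} (T : andreevBilliard R).
Implicit Types (s : bool) (i j : 'I_(nsides T)) (x y z u : R * R).

Lemma tableN s : table T (~~ s) = mirror (axis T) @^-1` table T s.
Proof.
case: s => /=; first exact: mirror_image.
rewrite mirror_image -comp_preimage (_ : _ \o _ = id) //.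
by apply/funext => x; exact: mirrorK.
Qed.

Lemma boundaryN s : boundary T (~~ s) = mirror (axis T) @^-1` boundary T s.
Proof.
rewrite -mirror_image; apply/seteqP; split => [x [i [t [t01 ->]]]|_ [_ [i [t [t01 ->]] <-]]].
  exists (side_point (vertex s) i t); first by exists i, t.
  by rewrite side_pointN.
by exists i, t; rewrite side_pointN.
Qed.

Lemma table_interior_mirror s x :
  (table T s)° x -> (table T (~~ s))° (mirror (axis T) x).
Proof. by rewrite tableN interior_mirror /= mirrorK. Qed.

Lemma table_closed s : closed (table T s).
Proof.
have h : closed (region T) by apply: compact_closed; [exact: norm_hausdorff|exact: region_compact].
case: s => //=; rewrite mirror_image.
by apply: preimage_closed => // x _; exact: mirror_continuous.
Qed.

Lemma table_compact s : compact (table T s).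
Proof.
case: s => /=; first exact: region_compact.
apply: continuous_compact; last exact: region_compact.
by apply: continuous_subspaceT; exact: mirror_continuous.
Qed.

Lemma table_regular s : closure (table T s)° = table T s.
Proof.
case: s => /=; first exact: region_regular.
by rewrite mirror_image interior_mirror closure_mirror region_regular.
Qed.

Lemma table_boundary s : table T s `\` (table T s)° = boundary T s.
Proof.
case: s; first exact: region_boundary.
rewrite -[false]/(~~ true) boundaryN tableN interior_mirror.
by rewrite -[boundary T true](region_boundary T).
Qed.

Lemma interior_not_boundary s x : (table T s)° x -> ~ boundary T s x.
Proof. by move=> ix; rewrite -table_boundary => -[]. Qed.

Lemma boundary_table s x : boundary T s x -> table T s x.
Proof. by rewrite -table_boundary => -[]. Qed.

(** Off the boundary the table and its interior coincide, so the trace of the table on [A] is both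
    open and closed in [A]. *)
Lemma table_interior_connected s (A : set (R * R)) :
  connected A -> A `&` boundary T s = set0 ->
  A `&` table T s !=set0 -> A `<=` (table T s)°.
Proof.
move=> cA AB A0.
have AE : A `&` table T s = A `&` (table T s)°.
  apply/seteqP; split => x [Ax tx]; split => //; last exact: interior_subset.
  apply: contrapT => nx; have : (A `&` boundary T s) x.
    by split => //; rewrite -table_boundary.
  by rewrite AB.
have : A `&` table T s = A.
  apply: cA => //; first by exists (table T s)° => //; exact: open_interior.
  by exists (table T s) => //; exact: table_closed.
by rewrite AE => AI x; rewrite -[in X in X -> _]AI => -[].
Qed.

Lemma segment_connected x y : connected ((fun t : R => x + t *: (y - x)) @` `[0, 1]).
Proof.
apply: connected_continuous_connected; first exact/connected_intervalP/interval_is_interval.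
by apply: continuous_subspaceT; exact: line_continuous.
Qed.

Lemma segment_interior s x y : table T s x ->
  (forall t, 0 <= t <= 1 -> ~ boundary T s (x + t *: (y - x))) ->
  (table T s)° y.
Proof.
move=> tx nb.
have : (fun t : R => x + t *: (y - x)) @` `[0, 1] `<=` (table T s)°.
  apply: table_interior_connected; first exact: segment_connected.
  - rewrite -subset0 => _ [[t /= tI <-]]; apply: nb; by move: tI; rewrite in_itv.
  - exists x; split => //; exists 0; rewrite /= ?in_itv /= ?ler01 ?lexx//.
    by rewrite scale0r addr0.
by apply; exists 1; rewrite /= ?in_itv /= ?ler01 ?lexx// scale1r addrC subrK.
Qed.

Lemma closed_side_closed s i :
  closed [set side_point (vertex s) i t | t in `[0, 1]].
Proof.
apply: compact_closed.
  exact: norm_hausdorff.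
apply: continuous_compact; last exact: segment_compact.
by apply: continuous_subspaceT; exact: line_continuous.
Qed.

Lemma open_side_closed_side s i j x : open_side s i x ->
  [set side_point (vertex s) j t | t in `[0, 1]] x -> i = j.
Proof.
move=> [t /andP[t0 t1] ->] [t' /=]; rewrite in_itv /= => /andP[t'0].
rewrite le_eqVlt => /orP[/eqP ->|t'1] e.
  (* [simple_polygon] speaks of half-open sides: the endpoint of parameter 1 is read as the start of
     the next side. *)
  have [] := @vertex_simple _ T s i (ordS j) t 0 _ _ _; rewrite ?lexx ?ltr01 ?(ltW t0)//.
    by rewrite -e /side_point scale1r scale0r addr0 addrC subrK.
  by move=> _ t00; move: t0; rewrite t00 ltxx.
by have [] := @vertex_simple _ T s i j t t' _ _ (esym e); rewrite ?(ltW t0) ?t1 ?t'0 ?t'1.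
Qed.

End Table.

(** * Local structure at a side, and the inward normal *)

Section Local.
Context {R : realType} (T : andreevBilliard R).
Implicit Types (s : bool) (i j : 'I_(nsides T)) (x y z u : R * R).

Definition point s i (r : R) : R * R := vertex s i + r *: tangent s i.

(** The signed distance to the line carrying the side, positive to the left of the tangent. *)
Definition height s i x : R := cross (tangent s i) (x - vertex s i).

Definition abscissa s i x : R := dotp (x - vertex s i) (tangent s i).

Lemma side_length_gt0 s i : 0 < side_length s i.
Proof.
rewrite lt0r sqrtr_ge0 andbT; apply/negP => /eqP L0.
have := tangent_unit s i; rewrite /tangent L0 invr0 scale0r /dotp /= mul0r addr0.
by move=> /eqP; rewrite eq_sym oner_eq0.
Qed.

Lemma side_vectorE s i :
  vertex s (ordS i) - vertex s i = side_length s i *: tangent s i.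
Proof. by rewrite /tangent scalerA divff ?scale1r// gt_eqF// side_length_gt0. Qed.

Lemma open_sideP s i x :
  open_side s i x <-> exists2 r, 0 < r < side_length s i & x = point s i r.
Proof.
have L0 := side_length_gt0 s i; split.
  move=> [t /andP[t0 t1] ->]; exists (t * side_length s i); last first.
    by rewrite /side_point side_vectorE scalerA.
  by rewrite mulr_gt0//= -[ltRHS]mul1r ltr_pM2r.
move=> [r /andP[r0 rL] ->]; exists (r / side_length s i); last first.
  by rewrite /side_point side_vectorE scalerA divfK ?gt_eqF.
by rewrite divr_gt0//= ltr_pdivrMr// mul1r.
Qed.

Lemma tangent_unitE s i : (tangent s i).1 ^+ 2 + (tangent s i).2 ^+ 2 = 1.
Proof. by rewrite -(tangent_unit s i) /dotp -!expr2. Qed.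

Lemma height0P s i x : height s i x = 0 -> x = point s i (abscissa s i x).
Proof.
rewrite /height /abscissa /point /cross /dotp; have := tangent_unitE s i.
case: (tangent s i) x (vertex s i) => a b [c d] [p q] /= ab h.
congr pair; rewrite /= /GRing.scale /=.
  transitivity (p + (c - p) * (a ^+ 2 + b ^+ 2)); first by rewrite ab; ring.
  transitivity (p + ((c - p) * a + (d - q) * b) * a - b * (a * (d - q) - b * (c - p))).
    by ring.
  by rewrite h; ring.
transitivity (q + (d - q) * (a ^+ 2 + b ^+ 2)); first by rewrite ab; ring.
transitivity (q + ((c - p) * a + (d - q) * b) * b + a * (a * (d - q) - b * (c - p))).
  by ring.
by rewrite h; ring.
Qed.

Lemma height_move s i x u (t : R) :
  height s i (x + t *: u) = height s i x + t * cross (tangent s i) u.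
Proof. by rewrite /height /cross /= /GRing.scale /=; ring. Qed.

Lemma height_point s i r : height s i (point s i r) = 0.
Proof. by rewrite /height /cross /point /= /GRing.scale /=; ring. Qed.

Lemma abscissa_point s i r : abscissa s i (point s i r) = r.
Proof.
rewrite /abscissa /point; have := tangent_unitE s i.
case: (tangent s i) (vertex s i) => a b [c d] /= ab; rewrite /dotp /= /GRing.scale /=.
by transitivity (r * (a ^+ 2 + b ^+ 2)); [ring|rewrite ab mulr1].
Qed.

Lemma abscissa_continuous s i : continuous (abscissa s i).
Proof.
rewrite (_ : abscissa s i = fun x => (tangent s i).1 * x.1 + (tangent s i).2 * x.2
  - ((tangent s i).1 * (vertex s i).1 + (tangent s i).2 * (vertex s i).2)).
  exact: affine_form_continuous.
by apply/funext => x; rewrite /abscissa /dotp /=; ring.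
Qed.

(** The other closed sides are finitely many closed sets that miss [x], and the projection onto the
    line stays strictly between the two corners near [x]. *)
Lemma near_open_side s i x : open_side s i x ->
  \forall y \near x, (boundary T s y -> height s i y = 0) /\
                     (height s i y = 0 -> open_side s i y).
Proof.
move=> xi.
have nj : \forall y \near x, forall j, j != i ->
    ~ [set side_point (vertex s) j t | t in `[0, 1]] y.
  apply: (@filter_forall _ _ (fun j y => j != i ->
      ~ [set side_point (vertex s) j t | t in `[0, 1]] y) (nbhs x)
      (nbhs_filter x)) => j; have [->|ji] := eqVneq j i; first by apply: nearW.
  suff : \forall y \near x, (~` [set side_point (vertex s) j t | t in `[0, 1]]) y.
    by apply: filterS => y + _.
  apply: open_nbhs_nbhs; split; first exact/closed_openC/closed_side_closed.
  by move=> /(open_side_closed_side xi) ij; rewrite ij eqxx in ji.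
have [r /andP[r0 rL] xr] := (open_sideP s i x).1 xi.
have a0 : \forall y \near x, 0 < abscissa s i y.
  by apply: (cvgr_gt _ (@abscissa_continuous s i x)); rewrite xr abscissa_point.
have aL : \forall y \near x, abscissa s i y < side_length s i.
  by apply: (cvgr_lt _ (@abscissa_continuous s i x)); rewrite xr abscissa_point.
near=> y; split.
  move=> [j [t [t01 yE]]]; have [ji|ji] := eqVneq j i.
    by rewrite yE ji /side_point side_vectorE scalerA height_point.
  have : forall j, j != i -> ~ [set side_point (vertex s) j t | t in `[0, 1]] y by near: y.
  by move=> /(_ j ji)[]; exists t => //=; rewrite in_itv.
move=> /height0P yE; apply/open_sideP; exists (abscissa s i y) => //.
by apply/andP; split; near: y.
Unshelve. all: by end_near. Qed.

Lemma convex_lt (a b e t : R) : 0 <= t <= 1 -> a < e -> b < e -> a + t * (b - a) < e.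
Proof.
move=> /andP[t0 t1] ae be; have [ab|ba] := leP a b.
  have : 0 <= (1 - t) * (b - a) by apply: mulr_ge0; lra.
  lra.
have : 0 <= t * (a - b) by apply: mulr_ge0; lra.
lra.
Qed.

Lemma dist_convex (a b c e t : R) : 0 <= t <= 1 ->
  `|a - b| < e -> `|a - c| < e -> `|a - (b + t * (c - b))| < e.
Proof.
rewrite !ltr_norml => t01 /andP[b1 b2] /andP[c1 c2].
have b1' : b - a < e by lra.
have c1' : c - a < e by lra.
have := convex_lt t01 b1' c1'; have := convex_lt t01 b2 c2.
by move=> ? ?; apply/andP; split; lra.
Qed.

(** Balls are squares for the maximum norm, so convexity is checked on each coordinate. *)
Lemma ball_convex x y z (e t : R) : 0 <= t <= 1 ->
  ball x e y -> ball x e z -> ball x e (y + t *: (z - y)).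
Proof. by move=> t01 [y1 y2] [z1 z2]; split; exact: dist_convex. Qed.

(* Near an open side the boundary is a straight line, so that each of the two
   half-balls it cuts out lies in the interior of the table or in its
   complement; regularity of the table excludes that both do the same. *)
Definition inner_side s i (c : R) x := \forall y \near x,
  (0 < c * height s i y -> (table T s)° y) /\ (c * height s i y < 0 -> ~ table T s y).

Lemma open_side_inner s i x : open_side s i x ->
  inner_side s i 1 x \/ inner_side s i (-1) x.
Proof.
move=> xi; have [e /= e0 He] := (nbhs_ballP _ _).1 (near_open_side xi).
have half (c : R) y z : ball x e y -> ball x e z ->
    0 < c * height s i y -> 0 < c * height s i z -> table T s y -> (table T s)° z.
  move=> By Bz cy cz /segment_interior; apply => t t01 /(He _ (ball_convex t01 By Bz)).1.
  rewrite height_move => h0; have /andP[t0 t1] := t01.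
  have hz : cross (tangent s i) (z - y) = height s i z - height s i y.
    by rewrite /height /cross /=; ring.
  have := @convex_lt (- (c * height s i y)) (- (c * height s i z)) 0 t t01.
  rewrite !oppr_lt0 => /(_ cy cz); rewrite hz in h0.
  rewrite (_ : _ + _ = - (c * (height s i y + t * (height s i z - height s i y)))); last by ring.
  by rewrite h0 mulr0 oppr0 ltxx.
have bx := open_side_boundary xi.
(* By regularity a boundary point is a limit of interior points. Such a [y] cannot lie on the line
   of the side, so it selects one half-ball. *)
have [y [iy By]] : exists y, (table T s)° y /\ ball x e y.
  have := boundary_table bx; rewrite -{1}table_regular => /(_ (ball x e)).
  by case; [exact: nbhsx_ballx|move=> y []; exists y].
have main (c : R) : (c = 1 \/ c = -1) -> 0 < c * height s i y -> inner_side s i c x.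
  move=> c1 cy; apply/nbhs_ballP; exists e => //= z Bz; split => cz.
    exact: half By Bz cy cz (interior_subset iy).
  (* If the opposite half-ball also met the table, the whole ball would lie in the table, its
     diameter being boundary, and [x] would be interior. *)
  move=> tz; suff : (table T s)° x by move/interior_not_boundary.
  apply/nbhs_ballP; exists e => //= w Bw.
  have [cw|cw|cw] := ltgtP 0 (c * height s i w).
  - exact: interior_subset (half c y w By Bw cy cw (interior_subset iy)).
  - by apply: interior_subset (half (- c) z w Bz Bw _ _ tz); rewrite mulNr oppr_gt0.
  - have [_ hw] := He _ Bw; apply/boundary_table/(open_side_boundary (i := i))/hw.
    by case: c1 cw => -> /esym/eqP; rewrite ?mul1r ?mulN1r ?oppr_eq0 => /eqP.
have [h|h|h] := ltgtP 0 (height s i y).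
- by left; apply: main; [left|rewrite mul1r].
- by right; apply: main; [right|rewrite mulN1r oppr_gt0].
- have [_ hy] := He _ By; case: (interior_not_boundary iy).
  exact/(open_side_boundary (i := i))/hy.
Qed.

Lemma rot_cross (u w : R * R) : cross u (rot w) = dotp u w.
Proof. by rewrite /cross /dotp /=; ring. Qed.

Lemma ray_near x u (P : set (R * R)) : nbhs x P ->
  exists2 e, 0 < e & forall t, `|t| < e -> P (x + t *: u).
Proof.
move=> xP; have /(_ P) := @line_continuous R x u 0.
rewrite /= scale0r addr0 => /(_ xP)/nbhs_ballP[e /= e0 eP]; exists e => // t te.
by apply: eP; rewrite /ball /= sub0r normrN.
Qed.

Lemma cross_rot_tangent s i : cross (tangent s i) (rot (tangent s i)) = 1.
Proof. by rewrite rot_cross tangent_unit. Qed.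

Lemma open_side_height0 s i x : open_side s i x -> height s i x = 0.
Proof. by move=> /open_sideP[r _ ->]; rewrite height_point. Qed.

Lemma inner_side_unique s i x : open_side s i x ->
  inner_side s i 1 x -> inner_side s i (-1) x -> False.
Proof.
move=> xi P1 P2.
have [e e0 eP] := ray_near (rot (tangent s i)) (filterI P1 P2).
have /eP[] : `|e / 2| < e by rewrite gtr0_norm; lra.
rewrite height_move open_side_height0// cross_rot_tangent add0r mulr1.
move=> [] /(_ _)/interior_subset h1 _ [_ h2].
by apply: h2; [|apply: h1]; lra.
Qed.

Lemma point_continuous s i : continuous (point s i).
Proof. exact: line_continuous. Qed.

Lemma near_inner_side s i c r : inner_side s i c (point s i r) ->
  \forall r' \near r, inner_side s i c (point s i r').
Proof. by move=> /nbhs_interior/(@point_continuous s i r). Qed.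

(** Each sign is an open condition along the side, and the two exclude each other, so connectedness
    of the parameter interval leaves a single sign. This is what gives a side one inward normal. *)
Lemma inner_side_constant s i : exists c, (c = 1 \/ c = -1) /\
  forall x, open_side s i x -> inner_side s i c x.
Proof.
pose I : set R := `]0, side_length s i[%classic.
have Iopen r : I r -> open_side s i (point s i r).
  by rewrite /I /= in_itv /= => ?; apply/open_sideP; exists r.
have [[r [Ir Pr]]|N] := pselect (I `&` [set r | inner_side s i 1 (point s i r)] !=set0).
  have cI : connected I by exact/connected_intervalP/interval_is_interval.
  have IE : I `&` [set r | inner_side s i 1 (point s i r)] = I.
    apply: cI; first by exists r.
      exists [set r | inner_side s i 1 (point s i r)] => //.
      by rewrite openE => r' /near_inner_side.
    exists (~` [set r | inner_side s i (-1) (point s i r)]).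
      by apply: open_closedC; rewrite openE => r' /near_inner_side.
    apply/seteqP; split => r' [Ir' /= Pr']; split => //.
      by move=> /(inner_side_unique (Iopen _ Ir') Pr').
    by have [] := open_side_inner (Iopen _ Ir').
  exists 1; split; first by left.
  move=> x /open_sideP[r' r'I ->]; have : I r' by rewrite /I /= in_itv.
  by rewrite -IE => -[].
exists (-1); split; first by right.
move=> x xi; have [Px|//] := open_side_inner xi; exfalso; apply: N.
move: xi Px => /open_sideP[r rI ->] Px; exists r; split => //.
Qed.

(** A direction parallel to the side is excluded because it stays on the boundary for a short time,
    one of the wrong sign because it leaves the table. *)
Lemma inner_side_inward s i c x u : (c = 1 \/ c = -1) -> open_side s i x ->
  inner_side s i c x -> inward T s x u <-> 0 < c * cross (tangent s i) u.
Proof.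
move=> c1 xi Px; split => [[e e0 eP]|cu].
  have [e' e'0 e'P] := ray_near u (filterI (near_open_side xi) Px).
  pose t := Num.min e e' / 2.
  have m0 : 0 < Num.min e e' by rewrite lt_min e0.
  have mE : Num.min e e' <= e by rewrite ge_min lexx.
  have mE' : Num.min e e' <= e' by rewrite ge_min lexx orbT.
  have t0 : 0 < t by rewrite /t; lra.
  have /eP it : 0 < t < e by apply/andP; split; rewrite /t; lra.
  have /e'P[] : `|t| < e' by rewrite gtr0_norm// /t; lra.
  rewrite height_move open_side_height0// add0r => -[_ h0] [_ hN].
  have [//|cN|c0] := ltgtP 0 (c * cross (tangent s i) u).
    case: hN; last exact: interior_subset.
    by rewrite mulrCA pmulr_rlt0.
  have u0 : cross (tangent s i) u = 0.
    by case: c1 c0 => -> /esym/eqP; rewrite ?mul1r ?mulN1r ?oppr_eq0 => /eqP.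
  case: (interior_not_boundary it); apply: open_side_boundary (h0 _).
  by rewrite u0 mulr0.
have [e e0 eP] := ray_near u Px; exists e => // t /andP[t0 te].
have [|+ _] := eP t; first by rewrite gtr0_norm.
by apply; rewrite height_move open_side_height0// add0r mulrCA mulr_gt0.
Qed.

Lemma open_side_nonempty s i : open_side s i (point s i (side_length s i / 2)).
Proof.
by apply/open_sideP; exists (side_length s i / 2) => //; have := side_length_gt0 s i; lra.
Qed.

(** Equal to 1 when the table lies to the left of the oriented side and to -1 when it lies to the
    right. *)
Definition side_sign s i : R := cross (tangent s i) (normal s i).

Lemma normal_spec s i : [/\ (side_sign s i = 1 \/ side_sign s i = -1),
  normal s i = side_sign s i *: rot (tangent s i) &
  forall x, open_side s i x -> inner_side s i (side_sign s i) x].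
Proof.
have [c [c1 cP]] := inner_side_constant s i.
have cc : c * c = 1 by case: c1 => ->; ring.
have dZ (a : R) u : dotp (a *: u) (a *: u) = a * a * dotp u u.
  by rewrite /dotp /= /GRing.scale /=; ring.
have dR u : dotp (rot u) (rot u) = dotp u u by rewrite /dotp /=; ring.
have [nu1 nu0 nui] : [/\ unit_circle (normal s i),
    dotp (normal s i) (tangent s i) = 0 &
    forall x, open_side s i x -> inward T s x (normal s i)].
  apply: (@xgetPex _ 0 [set nu | [/\ unit_circle nu, dotp nu (tangent s i) = 0 &
                       forall x, open_side s i x -> inward T s x nu]]).
  (* [normal] is a choice from a set; this witness shows that the set is nonempty. Below, the three
     defining conditions force the chosen vector to be this one. *)
  exists (c *: rot (tangent s i)); split.
  - by rewrite /unit_circle /= dZ cc mul1r dR tangent_unit.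
  - by rewrite /dotp /= /GRing.scale /=; ring.
  - move=> x xi; apply/(inner_side_inward _ c1 xi (cP x xi)).
    rewrite (_ : cross _ _ = c * cross (tangent s i) (rot (tangent s i))).
      by rewrite cross_rot_tangent mulr1 cc.
    by rewrite /cross /= /GRing.scale /=; ring.
have xi := open_side_nonempty s i.
have c0 := (inner_side_inward _ c1 xi (cP _ xi)).1 (nui _ xi).
have nuE : normal s i = side_sign s i *: rot (tangent s i).
  move: nu0 (tangent_unit s i); rewrite /side_sign /cross /dotp.
  case: (tangent s i) (normal s i) => a b [p q] /= h0 h1.
  congr pair; rewrite /= /GRing.scale /=.
    transitivity (p * (a * a + b * b) - (p * a + q * b) * a); last by ring.
    by rewrite h0 h1; ring.
  transitivity (q * (a * a + b * b) - (p * a + q * b) * b); last by ring.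
  by rewrite h0 h1; ring.
have ss : side_sign s i * side_sign s i = 1.
  by move: nu1; rewrite /unit_circle /= nuE dZ dR tangent_unit mulr1.
have sc : side_sign s i = c.
  move: c0; rewrite -/(side_sign s i) => c0.
  have /eqP : (side_sign s i - 1) * (side_sign s i + 1) = 0.
    by rewrite -[RHS](subrr 1) -{3}ss; ring.
  rewrite mulf_eq0 => /orP[/eqP h|/eqP h]; case: c1 c0 => ->; lra.
by rewrite sc; split => //; rewrite -sc.
Qed.

End Local.

(** * Angles and scalar products *)

Section Angle.
Context {R : realType}.

Lemma cos_eq1 (x : R) : `|x| < 2 * pi -> cos x = 1 -> x = 0.
Proof.
move=> x2 c1.
have s0 : sin (`|x| / 2) = 0.
  have xE : `|x| = (`|x| / 2) *+ 2 by rewrite -mulr_natr divfK.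
  have : cos `|x| = 1 by case: (normrEsign x) => ->; case: (x < 0);
    rewrite ?expr1 ?expr0 ?mulN1r ?mul1r ?cosN.
  rewrite {1}xE cos_mulr2n cos2sin2 mulr2n => h; apply/eqP; rewrite -sqrf_eq0; apply/eqP.
  lra.
apply/eqP; rewrite -normr_eq0; apply: contraTT isT => x0.
have : 0 < sin (`|x| / 2).
  apply: sin_gt0_pi; apply/andP; split; last by lra.
  by rewrite divr_gt0// lt0r x0 normr_ge0.
by rewrite s0 ltxx.
Qed.

(** The arc cosine fixes the angle up to sign, and the sign of [d] decides. The bound by pi matters
    later, for excluding ambiguity modulo 2 pi. *)
Lemma unit_angle (c d : R) : c ^+ 2 + d ^+ 2 = 1 ->
  exists b, [/\ `|b| <= pi, cos b = c & sin b = d].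
Proof.
move=> cd; have c1 : -1 <= c <= 1.
  by rewrite -ler_norml -(ler_pXn2r (n := 2))// ?nnegrE// expr1n -normrX ger0_norm ?sqr_ge0//;
    have := sqr_ge0 d; lra.
have sE : sin (acos c) = `|d|.
  by rewrite sin_acos// (_ : 1 - c ^+ 2 = d ^+ 2) ?sqrtr_sqr//; lra.
have [d0|d0] := leP 0 d.
  exists (acos c); split; rewrite ?acosK// ?sE ?ger0_norm ?acos_ge0 ?acos_lepi//.
exists (- acos c); split; rewrite ?cosN ?sinN ?acosK// ?sE ?normrN.
  by rewrite ger0_norm ?acos_ge0 ?acos_lepi.
by rewrite ltr0_norm// opprK.
Qed.

Implicit Types (u v w : R * R) (a : R).

Lemma dotpC u v : dotp u v = dotp v u.
Proof. by rewrite /dotp; ring. Qed.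

Lemma dotpDl u v w : dotp (u + v) w = dotp u w + dotp v w.
Proof. by rewrite /dotp /=; ring. Qed.

Lemma dotpZl a u w : dotp (a *: u) w = a * dotp u w.
Proof. by rewrite /dotp /= /GRing.scale /=; ring. Qed.

Lemma dotpNl u w : dotp (- u) w = - dotp u w.
Proof. by rewrite /dotp /=; ring. Qed.

Lemma dotpZr a u w : dotp w (a *: u) = a * dotp w u.
Proof. by rewrite /dotp /= /GRing.scale /=; ring. Qed.

Lemma dotp_lin a b u v w : dotp (a *: u + b *: v) w = a * dotp u w + b * dotp v w.
Proof. by rewrite dotpDl !dotpZl. Qed.

Lemma unit_perp_eq0 (t w : R * R) :
  dotp t t = 1 -> dotp w t = 0 -> cross t w = 0 -> w = 0.
Proof.
case: t w => a b [p q]; rewrite /dotp /cross /= => t1 d0 c0; congr pair.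
  transitivity (p * (a * a + b * b)); first by rewrite t1 mulr1.
  transitivity ((p * a + q * b) * a - (a * q - b * p) * b); first by ring.
  by rewrite d0 c0; ring.
transitivity (q * (a * a + b * b)); first by rewrite t1 mulr1.
transitivity ((p * a + q * b) * b + (a * q - b * p) * a); first by ring.
by rewrite d0 c0; ring.
Qed.

End Angle.

(** * Directions in the frame of a side *)

Section Direction.
Context {R : realType} (T : andreevBilliard R).
Implicit Types (s : bool) (i j : 'I_(nsides T)) (x y z u : R * R).

Definition direction s i (phi : R) : R * R :=
  sin phi *: tangent s i + cos phi *: normal s i.

Lemma side_sign_sqr s i : side_sign s i * side_sign s i = 1.
Proof. by have [[->|->] _ _] := normal_spec s i; ring. Qed.

Lemma normal_unit s i : dotp (normal s i) (normal s i) = 1.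
Proof.
have [_ -> _] := normal_spec s i; rewrite dotpZl dotpZr mulrA side_sign_sqr mul1r.
by rewrite -[RHS](tangent_unit s i) /dotp /=; ring.
Qed.

Lemma normal_tangent s i : dotp (normal s i) (tangent s i) = 0.
Proof. by have [_ -> _] := normal_spec s i; rewrite dotpZl /dotp /=; ring. Qed.

Lemma dotp_direction_tangent s i phi : dotp (direction s i phi) (tangent s i) = sin phi.
Proof.
by rewrite /direction dotp_lin tangent_unit normal_tangent mulr1 mulr0 addr0.
Qed.

Lemma dotp_direction_normal s i phi : dotp (direction s i phi) (normal s i) = cos phi.
Proof.
rewrite /direction dotp_lin normal_unit (dotpC (tangent s i)).
by rewrite normal_tangent mulr1 mulr0 add0r.
Qed.

Lemma dotp_normal s i u : dotp u (normal s i) = side_sign s i * cross (tangent s i) u.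
Proof.
by have [_ -> _] := normal_spec s i; rewrite dotpZr /dotp /cross /=; ring.
Qed.

Lemma cross_tangent s i u : cross (tangent s i) u = side_sign s i * dotp u (normal s i).
Proof. by rewrite dotp_normal mulrA side_sign_sqr mul1r. Qed.

Lemma side_coord_eq0 s i u : dotp u (tangent s i) = 0 -> dotp u (normal s i) = 0 -> u = 0.
Proof.
move=> ut un; apply: (unit_perp_eq0 (tangent_unit s i)) => //.
by rewrite cross_tangent un mulr0.
Qed.

Lemma side_coord_inj s i u w : dotp u (tangent s i) = dotp w (tangent s i) ->
  dotp u (normal s i) = dotp w (normal s i) -> u = w.
Proof.
move=> ut un; apply/eqP; rewrite -subr_eq0; apply/eqP.
by apply: (@side_coord_eq0 s i); rewrite dotpDl dotpNl ?ut ?un subrr.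
Qed.

Lemma side_coordE s i u :
  u = dotp u (tangent s i) *: tangent s i + dotp u (normal s i) *: normal s i.
Proof.
apply: (@side_coord_inj s i); rewrite dotp_lin.
  by rewrite tangent_unit normal_tangent mulr1 mulr0 addr0.
by rewrite (dotpC (tangent s i)) normal_unit normal_tangent mulr1 mulr0 add0r.
Qed.

Lemma direction_unit s i phi : dotp (direction s i phi) (direction s i phi) = 1.
Proof.
rewrite {1}/direction dotp_lin !(dotpC _ (direction _ _ _)).
by rewrite dotp_direction_tangent dotp_direction_normal -!expr2 addrC cos2Dsin2.
Qed.

Lemma direction_surj s i u : dotp u u = 1 -> 0 < dotp u (normal s i) ->
  exists2 phi, - (pi / 2) < phi < pi / 2 & u = direction s i phi.
Proof.
move=> u1 un.
have e1 : dotp u (tangent s i) ^+ 2 + dotp u (normal s i) ^+ 2 = 1.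
  rewrite -[RHS]u1 [in RHS](side_coordE s i u) dotp_lin.
  by rewrite -(side_coordE s i u) !(dotpC _ u) -!expr2.
have c1 : -1 < dotp u (tangent s i) < 1.
  have : 0 < dotp u (normal s i) ^+ 2 by rewrite exprn_gt0.
  by move: e1; set p := dotp u _; set q := dotp u _ => e1 q0; apply/andP; split; nra.
have /andP[c2 c3] := c1.
exists (asin (dotp u (tangent s i))).
  by rewrite asin_gtNpi2 ?asin_ltpi2 ?c2 ?c3 ?(ltW c2) ?(ltW c3).
apply: (@side_coord_inj s i).
  by rewrite dotp_direction_tangent asinK// in_itv /= !ltW.
rewrite dotp_direction_normal cos_asin; last by rewrite !ltW.
by rewrite (_ : 1 - _ = dotp u (normal s i) ^+ 2) ?sqrtr_sqr ?gtr0_norm//; lra.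
Qed.

Lemma inwardP s i x u : open_side s i x -> inward T s x u <-> 0 < dotp u (normal s i).
Proof.
move=> xi; rewrite dotp_normal; have [s1 _ sP] := normal_spec s i.
exact: (inner_side_inward u s1 xi (sP x xi)).
Qed.

(** The vector [- direction s j (- phi')] is the arriving direction whose reflection is
    [direction s j phi']. The polar angle of a direction is a constant minus [side_sign s i * phi];
    comparing both sides gives an affine relation between the angles, of slope
    [- (side_sign s i * side_sign s j)]. *)
Lemma flight_angle s i j : exists e b, `|e| = 1 /\
  forall phi phi', - (pi / 2) < phi < pi / 2 -> - (pi / 2) < phi' < pi / 2 ->
    direction s i phi = - direction s j (- phi') <-> phi' = e * phi + b.
Proof.
pose c := dotp (tangent s i) (tangent s j); pose d := cross (tangent s j) (tangent s i).
pose e := - (side_sign s i * side_sign s j).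
have cd : (e * c) ^+ 2 + (- (side_sign s i * d)) ^+ 2 = 1.
  transitivity (side_sign s i * side_sign s i * (side_sign s j * side_sign s j * c ^+ 2 + d ^+ 2)).
    by rewrite /e; ring.
  rewrite !side_sign_sqr !mul1r.
  transitivity (dotp (tangent s i) (tangent s i) * dotp (tangent s j) (tangent s j)).
    by rewrite /c /d /dotp /cross; ring.
  by rewrite !tangent_unit mulr1.
(* The values of cos b and sin b are read off at phi = 0, where the direction is the normal of the
   side [i]. *)
have [b [bpi cb sb]] := unit_angle cd.
have e1 : e = 1 \/ e = -1.
  rewrite /e; have [[->|->] _ _] := normal_spec s i;
  have [[->|->] _ _] := normal_spec s j; rewrite ?mulrNN ?mulr1 ?mul1r ?opprK;
  [right|left|left|right] => //.
have cosE phi : cos (e * phi + b) = cos phi * (e * c) + e * sin phi * (side_sign s i * d).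
  rewrite cosD cb sb; case: e1 => ->; rewrite ?mulN1r ?mul1r ?cosN ?sinN; ring.
have sinE phi : sin (e * phi + b) = sin phi * c - cos phi * (side_sign s i * d).
  rewrite sinD cb sb; case: e1 => ->; rewrite ?mulN1r ?mul1r ?cosN ?sinN; ring.
have ds phi : dotp (direction s i phi) (tangent s j) = sin (e * phi + b).
  rewrite sinE /direction; have [_ -> _] := normal_spec s i.
  rewrite dotp_lin (dotpZl (side_sign _ _)) /c /d /dotp /cross /rot.
  by move: (tangent s i) (tangent s j) => [? ?] [? ?] /=; ring.
have dc phi : dotp (direction s i phi) (normal s j) = - cos (e * phi + b).
  rewrite cosE /direction; have [_ -> _] := normal_spec s i; have [_ -> _] := normal_spec s j.
  transitivity (side_sign s j * (sin phi * d) + side_sign s i * side_sign s j * (cos phi * c)).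
    rewrite dotp_lin !(dotpZr (side_sign _ _)) (dotpZl (side_sign _ _)) /c /d /dotp /cross /rot.
    by move: (tangent s i) (tangent s j) => [? ?] [? ?] /=; ring.
  rewrite -[X in X * (sin phi * d)]mul1r -(side_sign_sqr s i).
  by rewrite /e; ring.
exists e, b; split; first by case: e1 => ->; rewrite ?normrN normr1.
move=> phi phi' /andP[p1 p2] /andP[p1' p2']; split => [h|->].
  have sP : sin phi' = sin (e * phi + b).
    by rewrite -ds h dotpNl dotp_direction_tangent sinN opprK.
  have cP : cos phi' = cos (e * phi + b).
    by apply: oppr_inj; rewrite -dc h dotpNl dotp_direction_normal cosN.
  (* Equality of sines and cosines is only equality modulo 2 pi; the difference is smaller than pi /
     2 + pi / 2 + pi in absolute value, hence zero. *)
  apply/eqP; rewrite -subr_eq0; apply/eqP; apply: cos_eq1.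
    have : `|e * phi| < pi / 2.
      by case: e1 => ->; rewrite ?mulN1r ?mul1r ltr_norml; apply/andP; split; lra.
    rewrite ltr_norml => /andP[? ?]; move: bpi; rewrite ler_norml => /andP[? ?].
    by rewrite ltr_norml; apply/andP; split; lra.
  by rewrite cosB sP cP -!expr2 cos2Dsin2.
apply: (@side_coord_inj s j); rewrite dotpNl.
  by rewrite ds dotp_direction_tangent sinN opprK.
by rewrite dc dotp_direction_normal cosN.
Qed.

End Direction.

(** * Flights between two sides *)

Section Flight.
Context {R : realType} (T : andreevBilliard R).
Implicit Types (s : bool) (i j k : 'I_(nsides T)) (x y u z : R * R).

(** Plays two roles: reversal of time along a flight, and passage to the other copy on the Andreev
    side. *)
Definition flip (z : R * R) : R * R := (z.1, - z.2).

Lemma flipK : involutive flip.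
Proof. by move=> [r phi]; rewrite /flip /= opprK. Qed.

Lemma coord_domP s i z : coord_dom s i z <->
  0 < z.1 < side_length s i /\ - (pi / 2) < z.2 < pi / 2.
Proof.
rewrite /coord_dom; split=> -[] /=; rewrite ?in_itv /= => z1 z2;
  by split; rewrite /= ?in_itv.
Qed.

Lemma coord_dom_flip s i z : coord_dom s i (flip z) <-> coord_dom s i z.
Proof.
rewrite !coord_domP /flip /=; split=> -[-> /andP[? ?]]; split => //;
  by apply/andP; split; lra.
Qed.

Lemma point_open_side s i z : coord_dom s i z -> open_side s i (point s i z.1).
Proof. by move=> /coord_domP[zr _]; apply/open_sideP; exists z.1. Qed.

Lemma coord_dom_cos_gt0 s i z : coord_dom s i z -> 0 < cos z.2.
Proof. by move=> /coord_domP[_]; exact: cos_gt0_pihalf. Qed.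

Lemma inward_direction s i z : coord_dom s i z ->
  inward T s (point s i z.1) (direction s i z.2).
Proof.
move=> zi; apply/(inwardP _ (point_open_side zi)).
by rewrite dotp_direction_normal (coord_dom_cos_gt0 zi).
Qed.

Definition visible s x y := forall t, 0 < t < 1 -> (table T s)° (x + t *: (y - x)).

Lemma visible_sym s x y : visible s x y -> visible s y x.
Proof.
move=> V t /andP[t0 t1]; rewrite (_ : _ + _ = x + (1 - t) *: (y - x)).
  by apply: V; apply/andP; split; lra.
by congr pair; rewrite /= /GRing.scale /=; ring.
Qed.

Lemma visible_boundary s x u (t t' : R) : 0 < t -> 0 < t' ->
  visible s x (x + t *: u) -> boundary T s (x + t' *: u) -> t <= t'.
Proof.
move=> t0 t'0 V b; rewrite leNgt; apply/negP => tt'.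
have /V : 0 < t' / t < 1 by rewrite divr_gt0//= ltr_pdivrMr// mul1r.
rewrite (_ : _ + _ = x + t' *: u) => [/interior_not_boundary//|].
by congr pair; rewrite /= /GRing.scale /=; field; rewrite gt_eqF.
Qed.

(* The line leaving the point [z.1] of the side [i] at the angle [z.2] next
   meets the boundary at the point [z'.1] of the side [j], and is reflected
   there at the angle [z'.2]. *)
Definition flight s i j z z' : Prop := [/\ coord_dom s i z, coord_dom s j z',
  exists2 t, 0 < t & point s j z'.1 = point s i z.1 + t *: direction s i z.2,
  direction s i z.2 = - direction s j (- z'.2) &
  visible s (point s i z.1) (point s j z'.1)].

(** Time reversal: the opposite of the arriving direction leaves the side [j] at the angle
    [- z'.2]. *)
Lemma flight_sym s i j z z' : flight s i j z z' -> flight s j i (flip z') (flip z).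
Proof.
move=> [zi z'j [t t0 zt] zd V]; split; rewrite ?coord_dom_flip//=.
- exists t => //; rewrite zt zd scalerN addrNK//.
- by rewrite opprK zd opprK.
- exact: visible_sym.
Qed.

(** The left-hand side is the difference of the signed distances of the two parallel lines through
    the two points. It is affine in [r] and [r'], with coefficients cos(phi) and cos(phi') up to
    sign; its vanishing is the position equation of a flight. *)
Lemma cross_point s i j (r r' phi phi' : R) :
  direction s i phi = - direction s j (- phi') ->
  cross (point s j r' - point s i r) (direction s i phi) = side_sign s j *
    (- (side_sign s i * side_sign s j) * cos phi * r +
     - (side_sign s j * cross (vertex s i - vertex s j) (direction s i phi)) -
     cos phi' * r').
Proof.
move=> e.
have ci : cross (tangent s i) (direction s i phi) = side_sign s i * cos phi.
  by rewrite cross_tangent dotp_direction_normal.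
have cj : cross (tangent s j) (direction s i phi) = - (side_sign s j * cos phi').
  by rewrite e cross_tangent dotpNl dotp_direction_normal cosN mulrN.
transitivity (r' * cross (tangent s j) (direction s i phi) -
  r * cross (tangent s i) (direction s i phi) -
  cross (vertex s i - vertex s j) (direction s i phi)).
  rewrite /point /cross; move: (tangent s i) (tangent s j) (direction s i phi).
  by move=> [? ?] [? ?] [? ?]; rewrite /= /GRing.scale /=; ring.
have sE a : a = side_sign s j * side_sign s j * a by rewrite side_sign_sqr mul1r.
rewrite ci cj [X in _ - X - _]sE [X in _ - X]sE; ring.
Qed.

Lemma flight_position s i j z z' : flight s i j z z' ->
  cos z'.2 * z'.1 = - (side_sign s i * side_sign s j) * cos z.2 * z.1 +
    - (side_sign s j * cross (vertex s i - vertex s j) (direction s i z.2)).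
Proof.
move=> [_ _ [t _ zt] zd _]; have := cross_point z.1 z'.1 zd.
rewrite (_ : cross _ _ = 0); last first.
  by rewrite zt /cross /= /GRing.scale /=; ring.
have s0 : side_sign s j != 0.
  by have [[->|->] _ _] := normal_spec s j; rewrite ?oppr_eq0 oner_eq0.
by move=> /esym/eqP; rewrite mulf_eq0 (negbTE s0) /= subr_eq0 => /eqP.
Qed.

(** The position equation puts both points on one line; visibility then shows that the second point
    lies ahead of the first and not behind it. *)
Lemma flight_of_position s i j z z' : coord_dom s i z -> coord_dom s j z' ->
  direction s i z.2 = - direction s j (- z'.2) ->
  cos z'.2 * z'.1 = - (side_sign s i * side_sign s j) * cos z.2 * z.1 +
    - (side_sign s j * cross (vertex s i - vertex s j) (direction s i z.2)) ->
  visible s (point s i z.1) (point s j z'.1) -> flight s i j z z'.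
Proof.
move=> zi z'j zd zp V; split => //.
have := cross_point z.1 z'.1 zd; rewrite -zp subrr mulr0 => c0.
set w := point s j z'.1 - point s i z.1 in c0.
(* The segment towards the arrival point runs in the interior, so [w] is inward. *)
have w0 : 0 < dotp w (normal s i).
  by apply/(inwardP _ (point_open_side zi)); exists 1.
have cz := coord_dom_cos_gt0 zi.
exists (dotp w (normal s i) / cos z.2); first by rewrite divr_gt0.
apply/eqP; rewrite addrC -subr_eq; apply/eqP; rewrite -/w.
have ct : sin z.2 * dotp w (normal s i) = cos z.2 * dotp w (tangent s i).
  have : side_sign s i * cross w (direction s i z.2) =
      cos z.2 * dotp w (tangent s i) - sin z.2 * dotp w (normal s i).
    transitivity (side_sign s i * side_sign s i * (cos z.2 * dotp w (tangent s i)) -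
      sin z.2 * (side_sign s i * cross (tangent s i) w)); last first.
      by rewrite dotp_normal side_sign_sqr mul1r.
    rewrite /direction; have [_ -> _] := normal_spec s i.
    by rewrite /cross /dotp /rot; move: (tangent s i) => [? ?]; rewrite /= /GRing.scale /=; ring.
  by rewrite c0 mulr0 => /esym/eqP; rewrite subr_eq0 => /eqP.
apply: (@side_coord_inj _ _ s i); rewrite dotpZl.
  by rewrite dotp_direction_tangent mulrAC [X in X / _]mulrC ct mulrC mulKf// gt_eqF.
by rewrite dotp_direction_normal divfK// gt_eqF.
Qed.

Lemma flight_inj_side s i j k z y y' : flight s i j z y -> flight s i k z y' -> j = k.
Proof.
move=> [zi yj [t t0 e] _ V] [_ yk [t' t'0 e'] _ V'].
have tt' : t = t'.
  apply/eqP; rewrite eq_le; apply/andP; split.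
    apply: (@visible_boundary s (point s i z.1) (direction s i z.2)) t0 t'0 _ _;
    first by rewrite -e; exact: V.
    by rewrite -e'; exact/open_side_boundary/point_open_side.
  apply: (@visible_boundary s (point s i z.1) (direction s i z.2)) t'0 t0 _ _;
    first by rewrite -e'; exact: V'.
  by rewrite -e; exact/open_side_boundary/point_open_side.
apply: open_side_inj (point_open_side yj) _.
by rewrite e tt' -e'; exact: point_open_side.
Qed.

Lemma flight_inj s i j z y y' : flight s i j z y -> flight s i j z y' -> y = y'.
Proof.
move=> f f'; have [e [b [_ eb]]] := flight_angle s i j.
have [/coord_domP[_ z2] yj _ d _] := f.
have [_ y'j _ d' _] := f'.
have [/coord_domP[_ y2] /coord_domP[_ y'2]] := (yj, y'j).
have E2 : y.2 = y'.2.
  have [h _] := eb _ _ z2 y2; have [h' _] := eb _ _ z2 y'2.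
  by rewrite (h d) (h' d').
have : y.1 = y'.1.
  have c0 : cos y'.2 != 0 by rewrite gt_eqF// (coord_dom_cos_gt0 y'j).
  by apply: (mulfI c0); rewrite (flight_position f') -(flight_position f) E2.
by move: E2; case: (y) (y') => a c [a' c'] /= -> ->.
Qed.

Lemma exit_time s x u : inward T s x u -> dotp u u = 1 ->
  exists t, [/\ 0 < t, boundary T s (x + t *: u) &
    forall t', 0 < t' < t -> (table T s)° (x + t' *: u)].
Proof.
move=> [e e0 eP] u1.
(* The lower bound keeps the starting time out of [A], since [x] itself may lie on the boundary;
   nothing is lost, the ray being in the interior before time [e]. *)
pose A : set R := [set t | e / 2 <= t /\ ~ (table T s)° (x + t *: u)].
have clA : closed A.
  rewrite (_ : A = `[e / 2, +oo[%classic `&`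
      (fun t : R => x + t *: u) @^-1` ~` (table T s)°).
    apply: closedI; first exact: interval_closed.
    apply: preimage_closed => [t _|]; first exact: line_continuous.
    by apply: open_closedC; exact: open_interior.
  by apply/seteqP; split => t [] /=; rewrite ?in_itv /= ?andbT.
have A0 : A !=set0.
  have /(@compact_bounded R _ _)[M0 [_ /(_ (`|M0| + 1))]] := @table_compact R T s.
  have -> : M0 < `|M0| + 1 by rewrite ltr_pwDr// ler_norm.
  move=> /(_ isT) MP; pose M := `|M0| + 1.
  have bnd y : table T s y -> `|y.1| <= M /\ `|y.2| <= M.
    by move=> /MP; rewrite /= prod_normE ge_max => /andP[].
  pose a := M + `|x.1|; pose b := M + `|x.2|.
  have a0 : 0 <= a by rewrite !addr_ge0.
  have b0 : 0 <= b by rewrite !addr_ge0.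
  (* At a time when the ray is in the table, its displacements along the axes are at most [a] and
     [b], so for a unit [u] the square of the time is at most a^2 + b^2, which this time exceeds. *)
  exists (a + b + 1 + e); split; first by lra.
  move=> /interior_subset/bnd[]; set t := _ + e => h1 h2.
  have tl (p q K : R) : `|p + t * q| <= K -> t * `|q| <= K + `|p|.
    move=> h; rewrite -[t]ger0_norm; last by rewrite /t; lra.
    by rewrite -normrM -[t * q](addKr p) (le_trans (ler_normD _ _))// normrN addrC lerD2r.
  have := tl _ _ _ h1; have := tl _ _ _ h2; rewrite -/a -/b => {}h2 {}h1.
  have tt : t ^+ 2 = (t * `|u.1|) ^+ 2 + (t * `|u.2|) ^+ 2.
    by rewrite !exprMn !real_normK ?num_real// -mulrDr !expr2 -[_ + _]/(dotp u u) u1 mulr1.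
  have h1' : (t * `|u.1|) ^+ 2 <= a ^+ 2.
    by rewrite ler_pXn2r// nnegrE// mulr_ge0// /t; lra.
  have h2' : (t * `|u.2|) ^+ 2 <= b ^+ 2.
    by rewrite ler_pXn2r// nnegrE// mulr_ge0// /t; lra.
  have : (a + b + 1 + e) ^+ 2 <= a ^+ 2 + b ^+ 2 by rewrite -/t tt lerD.
  by have := mulr_ge0 a0 b0; nra.
have lA : has_lbound A by exists (e / 2) => t [].
have iA : A (inf A).
  apply: clA => B /nbhs_ballP[d /= d0 dB].
  have [a Aa ai] := inf_adherent d0 (conj A0 lA).
  have ia := ge_inf lA Aa; exists a; split => //.
  by apply: dB; rewrite /ball /= ltr_norml; apply/andP; split; lra.
have [i1 i2] := iA.
have tin t' : 0 < t' < inf A -> (table T s)° (x + t' *: u).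
  move=> /andP[t'0 t'i]; apply: contrapT => nt'.
  have [t'e|et'] := ltP t' (e / 2).
    by apply/nt'/eP/andP; split => //; lra.
  by have := ge_inf lA (conj et' nt' : A t'); rewrite leNgt t'i.
exists (inf A); split => //; first by lra.
(* The exit point belongs to the table as a limit of the interior points reached just before. *)
rewrite -table_boundary; split => //; rewrite -table_regular => B nB.
have /nbhs_ballP[d /= d0 dB] := @line_continuous R x u (inf A) B nB.
pose t' := Num.max (inf A / 2) (inf A - d / 2).
have m1 : inf A / 2 <= t' by rewrite le_max lexx.
have m2 : inf A - d / 2 <= t' by rewrite le_max lexx orbT.
have m3 : t' < inf A by rewrite gt_max; apply/andP; split; lra.
exists (x + t' *: u); split; first by apply: tin; apply/andP; split; lra.
by apply: dB; rewrite /ball /= ltr_norml; apply/andP; split; lra.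
Qed.

End Flight.

(** * Measurability of flights and their effect on the measure *)

Section FlightMeasure.
Context {R : realType} (T : andreevBilliard R).
Implicit Types (s : bool) (i j k : 'I_(nsides T)) (x y u z : R * R).
Local Notation mu := (@lebesgue_measure R).

Lemma flight_of_ray s i k z (t : R) : coord_dom s i z -> 0 < t ->
  open_side s k (point s i z.1 + t *: direction s i z.2) ->
  (forall t', 0 < t' < t -> (table T s)° (point s i z.1 + t' *: direction s i z.2)) ->
  exists2 z', flight s i k z z' &
    point s k z'.1 = point s i z.1 + t *: direction s i z.2.
Proof.
set x := point s i z.1; set u := direction s i z.2 => zi t0 yk V.
have [r rI yr] := (open_sideP s k _).1 yk.
(* Seen from the arrival point, the path just travelled is an inward ray; this yields an angle
   strictly between - pi / 2 and pi / 2. *)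
have inN : inward T s (x + t *: u) (- u).
  exists t => // t' /andP[t'0 t't].
  rewrite (_ : _ + _ = x + (t - t') *: u); first by apply: V; apply/andP; split; lra.
  by rewrite scalerN -addrA -scalerBl.
have u1 : dotp (- u) (- u) = 1.
  by rewrite -(direction_unit s i z.2) -/u /dotp /=; ring.
have [psi psiI psiE] := direction_surj u1 ((inwardP _ yk).1 inN).
exists (r, - psi) => //; split => //.
- apply/coord_domP; split => //=; move: psiI => /andP[? ?].
  by apply/andP; split; lra.
- by exists t => //=; rewrite -yr.
- by rewrite /= opprK -psiE opprK.
- move=> t' /andP[t'0 t'1]; rewrite /= -yr (_ : _ + _ = x + (t' * t) *: u).
    by apply: V; rewrite mulr_gt0//= -[ltRHS]mul1r ltr_pM2r.
  by rewrite [X in X - _]addrC addrK scalerA.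
Qed.

(** The ray exits on some closed side; either at an inner point of it, or at an endpoint. In the
    second case only the fact that the line passes through a vertex is kept, a condition linear in
    [z.1]. *)
Lemma flight_or_corner s i z : coord_dom s i z ->
  (exists j z', flight s i j z z') \/
  exists k, cross (vertex s k - point s i z.1) (direction s i z.2) = 0.
Proof.
move=> zi; set x := point s i z.1; set u := direction s i z.2.
have [t [t0 [k [t1 [t1P yE]]] V]] := exit_time (inward_direction zi) (direction_unit s i z.2).
rewrite -/x -/u in yE V.
have crossu y : y = x + t *: u -> cross (y - x) u = 0.
  by move=> ->; rewrite /cross /= /GRing.scale /=; ring.
have [t10|t10] := eqVneq t1 0.
  right; exists k; apply: crossu.
  by rewrite yE t10 /side_point scale0r addr0.
have [t11|t11] := eqVneq t1 1.
  right; exists (ordS k); apply: crossu.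
  by rewrite yE t11 /side_point scale1r addrC subrK.
left; exists k; have /andP[t1ge t1le] := t1P.
have yk : open_side s k (x + t *: u).
  by exists t1 => //; rewrite lt0r t10 t1ge lt_neqAle t11.
by have [z' f _] := flight_of_ray zi t0 yk V; exists z'.
Qed.

Lemma cross_vertex_point s i k (r phi : R) :
  cross (vertex s k - point s i r) (direction s i phi) =
  cross (vertex s k - vertex s i) (direction s i phi) - r * (side_sign s i * cos phi).
Proof.
rewrite -(dotp_direction_normal s i) -cross_tangent /cross /point.
move: (tangent s i) (direction s i phi) => [? ?] [? ?].
by rewrite /= /GRing.scale /=; ring.
Qed.

(** For fixed [phi] the line through a given vertex determines [r], the coefficient of [r] being +-
    cos(phi), which is nonzero; there is at most one [r] per vertex. *)
Lemma no_flight_finite s i (phi : R) : finite_set (ysection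
  (coord_dom s i `\` \bigcup_j [set z | exists z', flight s i j z z']) phi).
Proof.
apply: (@sub_finite_set _ _ ((fun k : 'I_(nsides T) =>
  cross (vertex s k - vertex s i) (direction s i phi) / (side_sign s i * cos phi)) @` setT)).
  move=> r; rewrite ysectionE /= => -[zi N].
  have [[j [z' f]]|[k /= e]] := flight_or_corner zi.
    by exfalso; apply: N; exists j => //; exists z'.
  exists k => //; apply/eqP; move: e; rewrite cross_vertex_point => /eqP.
  rewrite subr_eq0 => /eqP ->; rewrite mulfK// mulf_neq0//.
    by have [[->|->] _ _] := normal_spec s i; rewrite ?oppr_eq0 oner_eq0.
  by rewrite gt_eqF// (coord_dom_cos_gt0 zi).
by apply: finite_image; exact: finite_finset.
Qed.

(** Visibility over the open interval of times is not visibly an open condition. Over a compact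
    subinterval it is, by the tube lemma, and countably many such subintervals exhaust the open
    one. *)
Lemma visible_measurable s i j :
  measurable [set p : R * R | visible T s (point s i p.1) (point s j p.2)].
Proof.
pose g (q : R * (R * R)) := point s i q.2.1 + q.1 *: (point s j q.2.2 - point s i q.2.1).
have gc : continuous g.
  move=> q; have c2 : q'.2 @[q' --> q] --> q.2 by exact: cvg_snd.
  have c21 : q'.2.1 @[q' --> q] --> q.2.1 by apply: (cvg_comp _ _ c2); exact: cvg_fst.
  have c22 : q'.2.2 @[q' --> q] --> q.2.2 by apply: (cvg_comp _ _ c2); exact: cvg_snd.
  have h1 : point s i q'.2.1 @[q' --> q] --> point s i q.2.1.
    by apply: (cvg_comp _ _ c21); exact: point_continuous.
  have h2 : point s j q'.2.2 @[q' --> q] --> point s j q.2.2.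
    by apply: (cvg_comp _ _ c22); exact: point_continuous.
  by apply: cvgD => //; apply: cvgZ; [exact: cvg_fst|apply: cvgB].
pose K (n : nat) : set R := `[n.+2%:R^-1, 1 - n.+2%:R^-1]%classic.
rewrite (_ : mkset _ = \bigcap_n [set p | K n `<=` [set t | (table T s)° (g (t, p))]]).
  apply: bigcapT_measurable => n; apply: open_measurable_prod.
  rewrite openE => p Kp; have /compact_near_coveringP cK : compact (K n) by exact: segment_compact.
  apply: (cK _ (nbhs p) (fun p t => (table T s)° (g (t, p)))) => t Kt.
  have /(gc (t, p)) : nbhs (g (t, p)) (table T s)°.
    by apply: open_nbhs_nbhs; split; [exact: open_interior|exact: Kp].
  by [].
apply/seteqP; split => p /=.
  move=> V n _ t; rewrite /K /= in_itv /= => /andP[t0 t1]; apply: V.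
  have n0 : 0 < n.+2%:R^-1 :> R by rewrite invr_gt0.
  by rewrite (lt_le_trans n0 t0) (le_lt_trans t1)// gtrBl.
move=> H t /andP[t0 t1].
have [n n1] : exists n : nat, n.+2%:R^-1 < Num.min t (1 - t).
  have m0 : 0 < Num.min t (1 - t) by rewrite lt_min t0 subr_gt0.
  exists (Num.bound (Num.min t (1 - t))^-1).
  rewrite invf_plt ?posrE//; apply: lt_trans (archi_boundP _) _; first by rewrite invr_ge0 ltW.
  by rewrite ltr_nat.
have := H n I t; apply; rewrite /K /= in_itv /=.
by move: n1; rewrite lt_min => /andP[/ltW -> /ltW]; rewrite lerBrDl -lerBrDr.
Qed.

Lemma sin_measurable : measurable_fun setT (@sin R).
Proof. by apply: continuous_measurable_fun; exact: continuous_sin. Qed.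

Lemma cross_direction_measurable s i (v : R * R) :
  measurable_fun setT (fun phi => cross v (direction s i phi)).
Proof.
rewrite (_ : (fun _ => _) = fun phi => cross v (tangent s i) * sin phi +
  cross v (normal s i) * cos phi).
  by apply: measurable_funD; apply: measurable_funM => //;
    [exact: sin_measurable|exact: cos_measurable].
apply/funext => phi; rewrite /cross /direction.
by move: (tangent s i) (normal s i) => [? ?] [? ?]; rewrite /= /GRing.scale /=; ring.
Qed.

Definition flight_preimage s i j (B : set (R * R)) : set (R * R) :=
  [set z | exists2 z', flight s i j z z' & B z'].

Lemma flight_preimage_measurable s i j B : measurable B ->
  measurable (flight_preimage s i j B).
Proof.
move=> mB; have [e [b [_ eb]]] := flight_angle s i j.
pose w phi := - (side_sign s j * cross (vertex s i - vertex s j) (direction s i phi)).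
(* The position equation solved for the arrival coordinate. The power function is measurable on the
   whole line and agrees with the inverse where the cosine is positive, as it is for angles in
   [coord_dom s j]. *)
pose F1 z := (- (side_sign s i * side_sign s j) * cos z.2 * z.1 + w z.2) *
  (cos (e * z.2 + b) `^ (-1)).
pose F z := (F1 z, e * z.2 + b).
have m2 : measurable_fun setT (fun z : R * R => e * z.2 + b).
  by apply: measurable_funD => //; apply: measurable_funM => //; exact: measurable_snd.
have mw : measurable_fun setT w.
  apply: measurableT_comp => //; apply: measurable_funM => //.
  exact: cross_direction_measurable.
have mF1 : measurable_fun setT F1.
  apply: measurable_funM.
    apply: measurable_funD.
      apply: measurable_funM; last exact: measurable_fst.
      apply: measurable_funM => //; apply: measurableT_comp; first exact: cos_measurable.
      exact: measurable_snd.
    by apply: measurableT_comp => //; exact: measurable_snd.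
  apply: (measurableT_comp (f := @powR R ^~ (-1))); first exact: measurable_powR.
  by apply: measurableT_comp => //; exact: cos_measurable.
have mF : measurable_fun setT F by apply/measurable_fun_pairP.
have mG : measurable_fun setT (fun z : R * R => (z.1, F1 z)).
  by apply/measurable_fun_pairP; split => //; exact: measurable_fst.
(* A flight exists exactly when the candidate [F z] lies on the side [j] and is visible from the
   starting point. *)
rewrite (_ : flight_preimage _ _ _ _ = coord_dom s i `&`
  (F @^-1` (coord_dom s j `&` B) `&` (fun z : R * R => (z.1, F1 z)) @^-1`
   [set p : R * R | visible T s (point s i p.1) (point s j p.2)])).
  apply: measurableI; first exact: measurable_coord_dom.
  apply: measurableI; rewrite -[X in measurable X]setTI.
    by apply: mF => //; apply: measurableI => //; exact: measurable_coord_dom.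
  by apply: mG => //; exact: visible_measurable.
have FE z z' : flight s i j z z' -> z' = F z.
  move=> f; have [zi z'j _ zd _] := f.
  have [/coord_domP[_ z2] /coord_domP[_ z'2]] := (zi, z'j).
  have e2 := (eb _ _ z2 z'2).1 zd.
  have c0 := coord_dom_cos_gt0 z'j.
  rewrite /F /F1 -(flight_position f) -e2 powR_inv1 ?ltW// mulrC mulKf ?gt_eqF//.
  by case: (z').
apply/seteqP; split => z.
  move=> [z' f Bz']; have [zi z'j _ _ V] := f.
  by move: z'j V Bz'; rewrite (FE _ _ f).
move=> [zi [[Fj BF] V]]; exists (F z) => //.
have [/coord_domP[_ z2] /coord_domP[_ z'2]] := (zi, Fj).
apply: flight_of_position => //; first exact: (eb _ _ z2 z'2).2.
have c0 := coord_dom_cos_gt0 Fj.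
by rewrite /= /F1 -[in cos _ `^ _]/((F z).2) powR_inv1 ?ltW// mulrC divfK ?gt_eqF.
Qed.

(** Time reversal turns the image of a flight into a preimage, for which measurability is known. *)
Lemma flight_image_flip s i j :
  [set z' | exists z, flight s i j z z'] = flip @^-1` flight_preimage s j i setT.
Proof.
apply/seteqP; split => z' /=; first by move=> [z /flight_sym f]; exists (flip z).
by move=> [z /flight_sym + _]; rewrite flipK; exists (flip z).
Qed.

Lemma flip_measurable : measurable_fun setT (@flip R).
Proof.
apply/measurable_fun_pairP; split; first exact: measurable_fst.
exact: (measurableT_comp (@oppr_measurable R setT) measurable_snd).
Qed.

Lemma measurable_preimage_flip (A : set (R * R)) : measurable A -> measurable (@flip R @^-1` A).
Proof. by move=> mA; rewrite -[X in measurable X]setTI; exact: flip_measurable. Qed.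

Lemma flight_image_measurable s i j : measurable [set z' | exists z, flight s i j z z'].
Proof.
rewrite flight_image_flip; apply: measurable_preimage_flip.
exact: flight_preimage_measurable.
Qed.

Local Open Scope ereal_scope.
Local Notation cosint A := (\int[mu \x mu]_(z in A) (cos z.2)%:E).

(** The angle relation and the position equation are the data of the skew affine correspondence. [B]
    is cut down to the image because part of it may be reached from other sides. *)
Lemma flight_integral s i j B : measurable B ->
  cosint (flight_preimage s i j B) = cosint (B `&` [set z' | exists z, flight s i j z z']).
Proof.
move=> mB; have [e [b [e1 eb]]] := flight_angle s i j.
have angle z z' : flight s i j z z' -> z'.2 = (e * z.2 + b)%R.
  by move=> [/coord_domP[_ z2] /coord_domP[_ z'2] _ zd _]; exact: (eb _ _ z2 z'2).1.
have e0 : e != 0%R by rewrite -normr_eq0 e1 oner_eq0.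
apply: (@skew_affine_invariance _ _ _ e b (- (side_sign s i * side_sign s j))%R
  (fun phi => - (side_sign s j * cross (vertex s i - vertex s j) (direction s i phi)))%R) => //.
- exact: flight_preimage_measurable.
- by apply: measurableI => //; exact: flight_image_measurable.
- by move=> z [z' [/coord_domP[]]].
- by move=> z' [_ [z [_ /coord_domP[]]]].
- have [[->|->] _ _] := normal_spec s i; have [[->|->] _ _] := normal_spec s j;
    by rewrite ?mulrNN ?mulN1r ?mulrN1 ?mulr1 ?opprK ?normrN normr1.
- move=> r y [z' f _]; rewrite -[y]/((r, y).2) -(angle _ _ f).
  by have [_ /coord_domP[]] := f.
- move=> r y [_ [z f]]; have /= /addIr/(mulfI e0) -> := angle _ _ f.
  by have [/coord_domP[]] := f.
(* The position equation can be solved for either end, so the other endpoint of the flight can only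
   be the prescribed pair. *)
move=> r r' y yI y'I h; split.
  move=> [z' f Bz']; suff <- : z' = (r', e * y + b)%R by split => //; exists (r, y).
  have [_ z'j _ _ _] := f; have c0 := coord_dom_cos_gt0 z'j.
  have E := angle _ _ f; have := flight_position f; rewrite /= -h -E /= => p.
  move: E p c0; case: (z') => a c /= -> p c0; congr pair.
  by apply: (mulfI (lt0r_neq0 c0)).
move=> [Bz' [z f]]; exists (r', e * y + b)%R => //.
suff <- : z = (r, y) by [].
have /= /addIr/(mulfI e0) E := angle _ _ f.
have [zi _ _ _ _] := f; have c0 := coord_dom_cos_gt0 zi.
have := flight_position f; rewrite /= h -E => /addIr.
have s0 : (- (side_sign s i * side_sign s j) != 0)%R.
  rewrite oppr_eq0 mulf_neq0//.
    by have [[->|->] _ _] := normal_spec s i; rewrite ?oppr_eq0 oner_eq0.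
  by have [[->|->] _ _] := normal_spec s j; rewrite ?oppr_eq0 oner_eq0.
rewrite -E in c0; move=> /(mulfI (mulf_neq0 s0 (lt0r_neq0 c0))) ->.
by rewrite E; case: (z).
Qed.

End FlightMeasure.

(** * The mirror in coordinates, and the Andreev side *)

Section Mirror.
Context {R : realType} (T : andreevBilliard R).
Implicit Types (s : bool) (i j k : 'I_(nsides T)) (x y u z : R * R).

Lemma side_vectorN s i : vertex (~~ s) (ordS i) - vertex (~~ s) i =
  (- (vertex s (ordS i) - vertex s i).1, (vertex s (ordS i) - vertex s i).2).
Proof. by rewrite !vertexN /mirror; congr pair => /=; ring. Qed.

Lemma side_lengthN s i : side_length (~~ s) i = side_length s i.
Proof.
by rewrite /side_length side_vectorN /enorm; congr Num.sqrt; rewrite /dotp /=; ring.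
Qed.

Lemma tangentN s i : tangent (~~ s) i = (- (tangent s i).1, (tangent s i).2).
Proof.
rewrite /tangent side_vectorN side_lengthN.
by congr pair; rewrite /= /GRing.scale /=; ring.
Qed.

Lemma pointN s i r : point (~~ s) i r = mirror (axis T) (point s i r).
Proof.
rewrite /point tangentN vertexN /mirror; move: (tangent s i) => [? ?].
by congr pair; rewrite /= /GRing.scale /=; ring.
Qed.

Lemma coord_domN s i z : coord_dom (~~ s) i z <-> coord_dom s i z.
Proof. by rewrite !coord_domP side_lengthN. Qed.

Lemma inwardN s x u : inward T s x u ->
  inward T (~~ s) (mirror (axis T) x) (- u.1, u.2).
Proof.
move=> [e e0 eP]; exists e => // t /eP/table_interior_mirror.
rewrite (_ : mirror _ (x + _) = mirror (axis T) x + t *: (- u.1, u.2)) //.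
by congr pair; rewrite /= /GRing.scale /=; ring.
Qed.

(** The mirror fixes vertical vectors and reverses horizontal ones, so on a vertical side the copies
    share the tangent and have opposite inward normals. This is why changing copy acts on the angle
    by a sign. *)
Lemma andreev_vertical_side : exists i, [/\
  forall s, andreev_set T s `<=` open_side s i,
  forall s, tangent (~~ s) i = tangent s i &
  forall s, normal (~~ s) i = - normal s i].
Proof.
have [i vi Ai] := andreev_vertical T.
have t1 s : (tangent s i).1 = 0.
  have h : (tangent true i).1 = 0.
    by rewrite /tangent /= vi subrr /GRing.scale /= mulr0.
  case: s; first exact: h.
  by rewrite (tangentN true); exact: etrans (congr1 -%R h) (oppr0 _).
have tN s : tangent (~~ s) i = tangent s i.
  by rewrite tangentN t1 oppr0; move: (t1 s); case: (tangent s i) => ? ? /= ->.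
exists i; split => //.
  case => /=; first exact: Ai.
  by move=> _ [x /Ai Ax <-]; exact: (@open_sideN _ T true).
move=> s; have xi := open_side_nonempty s i.
have nE : (- (normal s i).1, (normal s i).2) = - normal s i.
  have [_ -> _] := normal_spec s i; rewrite /rot t1.
  by congr pair; rewrite /= /GRing.scale /=; ring.
have : inward T s (point s i (side_length s i / 2)) (normal s i).
  by apply/(inwardP _ xi); rewrite normal_unit.
(* The mirrored normal is inward in the other copy and equals [- normal s i]; this forces
   [side_sign] to change. *)
move=> /inwardN; rewrite nE => /(inwardP _ (open_sideN xi)).
rewrite dotp_normal tN -[X in cross _ X]scaleN1r.
have -> : cross (tangent s i) (-1 *: normal s i) = - side_sign s i.
  by rewrite /side_sign /cross /= /GRing.scale /=; ring.
move=> h; have [c n _] := normal_spec s i; have [cN nN _] := normal_spec (~~ s) i.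
have sN : side_sign (~~ s) i = - side_sign s i.
  by case: c => c; case: cN => cN; move: h; rewrite c cN; lra.
by rewrite nN n sN tN scaleNr.
Qed.

End Mirror.

(** * From classes to coordinates *)

Section Quotient.
Local Open Scope quotient_scope.
Context {R : realType} (T : andreevBilliard R).
Implicit Types (s : bool) (i j k : 'I_(nsides T)) (x y u z : R * R).
Local Notation class := (\pi_(collision_space T)).

Lemma reflection_normal s i u :
  dotp (reflection (tangent s i) u) (normal s i) = - dotp u (normal s i).
Proof.
rewrite /reflection dotpDl dotpNl dotpZl (dotpC (tangent s i)).
by rewrite normal_tangent mulr0 add0r.
Qed.

Lemma reflection_direction s i phi :
  reflection (tangent s i) (direction s i phi) = - direction s i (- phi).
Proof.
apply: (@side_coord_inj _ _ s i); last first.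
  by rewrite reflection_normal dotpNl !dotp_direction_normal cosN.
rewrite /reflection dotpDl !dotpNl dotpZl !dotp_direction_tangent.
by rewrite tangent_unit sinN opprK; ring.
Qed.

Lemma classP (p q : boundary_state T) :
  class p = class q <-> andreev_rel T (val p) (val q).
Proof.
split; first by move=> /eqmodP /asboolP.
by move=> h; apply/eqmodP/asboolP.
Qed.

(** A nontrivial partner has the opposite normal component. In clause (ii) this is reflection; in
    clause (iii) the added half-turn and the reversed normal of the other copy cancel, leaving again
    the sign change due to reflection. *)
Lemma inward_rep_unique s s' i i' x x' u u' :
  andreev_rel T ((s, x), u) ((s', x'), u') ->
  open_side s i x -> open_side s' i' x' -> inward T s x u -> inward T s' x' u' ->
  (((s, x), u) : state) = ((s', x'), u').
Proof.
move=> rel xi xi' /(inwardP _ xi) ux /(inwardP _ xi') ux'.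
case: rel => [[_ _ //]|[_ _ /= [ss xx] [-> //|[k xk uE]]]|[ax ax' h]].
- by rewrite ss xx.
- subst s' x'; have ki := open_side_inj xk xi; have ii := open_side_inj xi' xi.
  subst k i'; move: ux; rewrite uE reflection_normal /= => ux; exfalso; lra.
- case: h => [[/= -> -> //]|[/= [ss xx] [w [k /= xk wE] uE]]].
  have [i0 [Ai0 tN nN]] := andreev_vertical_side T.
  have ki := open_side_inj xk (Ai0 _ _ ax').
  have ii := open_side_inj xi (Ai0 _ _ ax).
  have ii' := open_side_inj xi' (Ai0 _ _ ax').
  subst k i i'; move: ux; rewrite uE wE ss nN.
  set n := normal s' i0; rewrite (_ : dotp (- _) (- n) = dotp (reflection (tangent s' i0) u') n).
    by rewrite reflection_normal => ?; exfalso; lra.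
  by rewrite /dotp /=; ring.
Qed.

Definition coord_state s i z : state := ((s, point s i z.1), direction s i z.2).

Lemma state_val (p : state) : boundary_state T p ->
  val (insubd (base_state T) p : boundary_state T) = p.
Proof. by move=> pB; rewrite insubdK//; exact/mem_set. Qed.

Lemma coord_state_boundary s i z : coord_dom s i z -> boundary_state T (coord_state s i z).
Proof.
move=> zi; split; last exact: direction_unit.
exact/open_side_boundary/point_open_side.
Qed.

(* The class of the state arriving on the side [j] of the copy [s], when [z]
   are the coordinates of its reflected direction. *)
Definition arrival s j z : collision_space T :=
  if `[< andreev_set T s (point s j z.1) >] then of_coord (~~ s) j (flip z)
  else of_coord s j z.

(** Away from the Andreev set the inward representative is the reflected direction, of angle [z.2].
    On it, the opposite of the reflected direction is taken in the other copy, where the reversed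
    normal gives it the angle [- z.2]. *)
Lemma arrival_class s j z (u : R * R) (q : boundary_state T) : coord_dom s j z ->
  u = - direction s j (- z.2) -> val q = ((s, point s j z.1), u) ->
  class q = arrival s j z.
Proof.
move=> zj uE qE; rewrite /arrival; case: asboolP => [Ay|nAy].
  have zjN : coord_dom (~~ s) j (flip z) by rewrite coord_domN coord_dom_flip.
  apply/classP; rewrite (state_val (coord_state_boundary zjN)) qE uE.
  have [i0 [Ai0 tN nN]] := andreev_vertical_side T.
  have ji := open_side_inj (point_open_side zj) (Ai0 _ _ Ay); subst i0.
  have AyN : andreev_set T (~~ s) (point (~~ s) j z.1).
    by rewrite pointN; exact: andreev_setN.
  apply: Or33; split => //=; right; split.
    by rewrite /rho /= pointN mirrorK negbK.
  exists (reflection (tangent (~~ s) j) (direction (~~ s) j (- z.2))).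
    by exists j => //; exact: Ai0.
  rewrite reflection_direction !opprK /direction tN nN sinN cosN.
  by rewrite opprD scaleNr !opprK scalerN.
apply/classP; rewrite (state_val (coord_state_boundary zj)) qE uE.
have yj := point_open_side zj.
apply: Or32; split => //=; try by split => //; exact: open_side_boundary yj.
by right; exists j => //=; rewrite reflection_direction.
Qed.

(** Eliminates the quotient: the departing state of a collision is inward, hence by uniqueness it is
    the coordinate state itself. *)
Lemma collides_of_coord s i z (c' : collision_space T) : coord_dom s i z ->
  collides (of_coord s i z) c' <->
  exists j z', flight s i j z z' /\ c' = arrival s j z'.
Proof.
move=> zi; have sv := state_val (coord_state_boundary zi).
have xi := point_open_side zi; split.
  move=> [p [q [/classP + -> ff]]]; rewrite sv.
  move: ff; rewrite /free_flight; case pE : (val p) => [[s1 x1] u1].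
  move=> [[i1 x1i] in1 [t [t0 nb [j yj] qE]]] rel.
  have [ss xx uu] := inward_rep_unique rel xi x1i (inward_direction zi) in1.
  subst s1 x1 u1; have [e e0 eP] := in1.
  set x := point s i z.1 in nb yj qE eP; set u := direction s i z.2 in nb yj qE eP.
  (* [free_flight] only keeps the trajectory off the boundary. Joining a point to an earlier one,
     taken while the ray is known to be inward, shows that it stays in the interior. *)
  have V t' : 0 < t' < t -> (table T s)° (x + t' *: u).
    move=> /andP[t'0 t't].
    have [t1 [t10 t1e t1t]] : exists t1, [/\ 0 < t1, t1 < e & t1 < t'].
      have m0 : 0 < Num.min e t' by rewrite lt_min e0.
      have m1 : Num.min e t' <= e by rewrite ge_min lexx.
      have m2 : Num.min e t' <= t' by rewrite ge_min lexx orbT.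
      by exists (Num.min e t' / 2); split; lra.
    apply: (@segment_interior _ T s (x + t1 *: u)).
      by apply: interior_subset; apply: eP; rewrite t10.
    move=> l /andP[l0 l1]; rewrite (_ : _ + _ = x + (t1 + l * (t' - t1)) *: u).
      have h1 : 0 <= l * (t' - t1) by apply: mulr_ge0; lra.
      have h2 : 0 <= (1 - l) * (t' - t1) by apply: mulr_ge0; lra.
      by apply: nb; apply/andP; split; lra.
    by congr pair; rewrite /= /GRing.scale /=; ring.
  have [z' f yE] := flight_of_ray zi t0 yj V.
  exists j, z'; split => //; have [_ z'j _ zd _] := f.
  by apply: (arrival_class z'j zd); rewrite qE yE.
move=> [j [z' [f ->]]]; have [_ z'j [t t0 yE] zd V] := f.
pose q : state := ((s, point s j z'.1), direction s i z.2).
have qB : boundary_state T q.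
  split; last exact: direction_unit.
  exact/open_side_boundary/point_open_side.
exists (insubd (base_state T) (coord_state s i z)), (insubd (base_state T) q); split => //.
  by apply/esym/(arrival_class z'j zd); rewrite state_val.
rewrite /free_flight sv /=; split; first by exists i.
  exact: inward_direction.
exists t; split => //.
- move=> t' /andP[t'0 t't]; apply: interior_not_boundary.
  have /V : 0 < t' / t < 1 by rewrite divr_gt0//= ltr_pdivrMr// mul1r.
  rewrite yE (_ : _ + _ = point s i z.1 + t' *: direction s i z.2) //.
  by rewrite [X in X - _]addrC addrK scalerA divfK// gt_eqF.
- by exists j; rewrite -yE; exact: point_open_side.
- by rewrite state_val// /q yE.
Qed.

Lemma collision_dom_of_coord s i z : coord_dom s i z ->
  collision_dom T (of_coord s i z) <-> exists j z', flight s i j z z'.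
Proof.
move=> zi; split; first by move=> [c' /(collides_of_coord _ zi)[j [z' [f _]]]]; exists j, z'.
move=> [j [z' f]]; exists (arrival s j z').
by apply/(collides_of_coord _ zi); exists j, z'.
Qed.

Lemma collision_map_of_coord s i j z z' : flight s i j z z' ->
  collision_map T (of_coord s i z) = arrival s j z'.
Proof.
move=> f; have [zi _ _ _ _] := f.
have : collides (of_coord s i z) (collision_map T (of_coord s i z)).
  apply: (@xgetPex _ _ [set c' | collides (of_coord s i z) c']).
  exists (arrival s j z'); apply/(collides_of_coord _ zi); by exists j, z'.
move=> /(collides_of_coord _ zi)[k [y [f' ->]]].
have jk := flight_inj_side f f'; subst k.
by rewrite (flight_inj f f').
Qed.

End Quotient.

(** * Integrals of the cosine over sets of coordinates *)

Section CosIntegral.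
Local Open Scope ereal_scope.
Context {R : realType}.
Implicit Types A B : set (R * R).
Local Notation mu := (@lebesgue_measure R).
Local Notation cosint A := (\int[mu \x mu]_(z in A) (cos z.2)%:E).

Definition strip : set (R * R) := [set z | - (pi / 2) < z.2 < pi / 2]%R.

Lemma strip_cos_ge0 A : A `<=` strip -> forall z, A z -> 0 <= (cos z.2)%:E.
Proof.
move=> As z /As /andP[z1 z2]; rewrite lee_fin; apply: cos_ge0_pihalf.
by rewrite !ltW.
Qed.

Lemma cos_snd_measurable A : measurable_fun A (fun z : R * R => (cos z.2)%:E).
Proof.
apply/measurable_EFinP; apply: measurable_funTS.
by apply: measurableT_comp; first exact: cos_measurable.
Qed.

Lemma cosint_bigcup (I : finType) (F : I -> set (R * R)) :
  (forall i, measurable (F i)) -> (forall i, F i `<=` strip) -> trivIset setT F ->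
  cosint (\bigcup_i F i) = \sum_(i : I) cosint (F i).
Proof.
move=> mF Fs tF; have UE : \bigcup_i F i = \big[setU/set0]_i F i.
  rewrite -bigcup_seq; congr (\bigcup_(i in _) _).
  by apply/seteqP; split => i _ //=; exact: mem_index_enum.
rewrite [in LHS]UE ge0_integral_bigsetU//.
- exact: index_enum_uniq.
- exact: sub_trivIset tF.
- exact: cos_snd_measurable.
- by rewrite -UE => z [i _ Fz]; exact: strip_cos_ge0 Fz.
Qed.

Lemma cosint_setID A B : measurable A -> measurable B -> A `<=` strip ->
  cosint A = cosint (A `&` B) + cosint (A `\` B).
Proof.
move=> mA mB As; rewrite -{1}(setUIDK A B) ge0_integral_setU//.
- exact: measurableI.
- exact: measurableD.
- exact: cos_snd_measurable.
- by rewrite setUIDK; exact: strip_cos_ge0.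
- by rewrite disj_set2E; apply/eqP; rewrite -subset0 => z [[_ Bz] [_]].
Qed.

Lemma cosint_flip A : measurable A -> A `<=` strip ->
  cosint (@flip R @^-1` A) = cosint A.
Proof.
move=> mA As; have flipI (y : R) : (- (pi / 2) < -1 * y + 0 < pi / 2 ->
    - (pi / 2) < y < pi / 2)%R by move=> /andP[? ?]; apply/andP; split; lra.
apply: (@skew_affine_invariance _ _ _ (-1)%R 0%R 1%R (fun=> 0%R)) => //.
- exact: measurable_preimage_flip.
- move=> [r y] /As; rewrite /strip /flip /= => /andP[? ?].
  by apply/andP; split; lra.
- by rewrite normrN normr1.
- by rewrite normr1.
- by move=> r y /As; rewrite /strip /flip /= mulN1r addr0.
- by move=> r y /As/flipI.
move=> r r' y yI _; rewrite mulN1r !addr0 cosN mul1r => /mulfI -> //.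
by apply: lt0r_neq0; exact: cos_gt0_pihalf.
Qed.

End CosIntegral.

(** * Balance over all sides and both copies *)

Section Invariance.
Local Open Scope ereal_scope.
Context {R : realType} (T : andreevBilliard R).
Implicit Types (s : bool) (i j k : 'I_(nsides T)) (E : set (collision_space T)).
Local Notation mu := (@lebesgue_measure R).
Local Notation cosint A := (\int[mu \x mu]_(z in A) (cos z.2)%:E).

Lemma coord_dom_strip s i : coord_dom s i `<=` strip.
Proof. by move=> z /coord_domP[]. Qed.

Lemma flight_preimage_dom s i j B : flight_preimage s i j B `<=` coord_dom s i.
Proof. by move=> z [z' []]. Qed.

(** [B] is split according to the side from which its points are reached. A point reached from no
    side is, after time reversal, one from which no flight starts, and these form finite
    sections. *)
Lemma cosint_flight_image s j B : measurable B -> B `<=` coord_dom s j ->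
  cosint B = \sum_i cosint (B `&` [set z' | exists z, flight s i j z z']).
Proof.
move=> mB Bj; pose H i := [set z' | exists z, flight s i j z z'].
have mH i : measurable (H i) by exact: flight_image_measurable.
have mU : measurable (\bigcup_i H i).
  by apply: fin_bigcup_measurable => //; exact: finite_finset.
have Bs : B `<=` strip by apply: subset_trans Bj _; exact: coord_dom_strip.
have N0 : cosint (B `\` \bigcup_i H i) = 0.
  apply: integral_cos_finite_ysection.
  - exact: measurableD.
  - by move=> z [/Bs /andP[? ?] _]; rewrite !ltW.
  - move=> y; apply: sub_finite_set (no_flight_finite s j (- y)) => r.
    rewrite !ysectionE /= => -[By N]; split.
      by rewrite -[(r, - y)%R]/(flip (r, y)); apply/coord_dom_flip/Bj.
    move=> [i _ [z f]]; apply: N; exists i => //; exists (flip z).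
    by have := flight_sym f; rewrite /flip /= opprK.
rewrite (@cosint_setID _ B (\bigcup_i H i))//.
rewrite [X in _ + X](_ : _ = 0)// adde0.
rewrite setI_bigcupr cosint_bigcup//.
- by move=> i; exact: measurableI.
- by move=> i z [/Bs].
apply/trivIsetP => i k _ _; apply: contra_neqP => /eqP/set0P[z [[_ [y f]] [_ [y' f']]]].
exact: (flight_inj_side (flight_sym f) (flight_sym f')).
Qed.

(** Double counting over pairs of sides: the left-hand side is split by the side of arrival, each
    [B j] by the side of departure. *)
Lemma cosint_flight_sum s (B : 'I_(nsides T) -> set (R * R)) :
  (forall j, measurable (B j)) -> (forall j, B j `<=` coord_dom s j) ->
  \sum_i cosint (\bigcup_j flight_preimage s i j (B j)) = \sum_j cosint (B j).
Proof.
move=> mB Bj.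
transitivity (\sum_i \sum_j cosint (flight_preimage s i j (B j))).
  apply: eq_bigr => i _; rewrite cosint_bigcup//.
  - by move=> j; exact: flight_preimage_measurable.
  - by move=> j z /flight_preimage_dom/coord_dom_strip.
  apply/trivIsetP => j k _ _; apply: contra_neqP => /eqP/set0P[z [[y f _] [y' f' _]]].
  exact: flight_inj_side f f'.
rewrite exchange_big; apply: eq_bigr => j _.
rewrite (cosint_flight_image (mB j) (Bj j)); apply: eq_bigr => i _.
exact: flight_integral.
Qed.

Definition andreev_coord s j : set (R * R) :=
  [set z | (0 < z.1 < side_length s j)%R /\ andreev_set T s (point s j z.1)].

Lemma andreev_coordN s j : andreev_coord (~~ s) j = andreev_coord s j.
Proof.
have sub s' : andreev_coord s' j `<=` andreev_coord (~~ s') j.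
  move=> z [zI Az]; split; first by rewrite side_lengthN.
  by rewrite pointN; exact: andreev_setN.
by apply/seteqP; split; [rewrite -{2}(negbK s)|]; exact: sub.
Qed.

Lemma andreev_set_connected s : connected (andreev_set T s).
Proof.
case: s => /=; first exact: andreev_connected.
apply: connected_continuous_connected; first exact: andreev_connected.
by apply: continuous_subspaceT; exact: mirror_continuous.
Qed.

(** The Andreev set is connected and contained in one side, so its arc-length coordinates form an
    interval, with no restriction on the angle. *)
Lemma andreev_coord_measurable s j : measurable (andreev_coord s j).
Proof.
have [i0 [Ai0 _ _]] := andreev_vertical_side T.
have [->|ji] := eqVneq j i0; last first.
  rewrite (_ : andreev_coord s j = set0) // -subset0 => z [zI /Ai0 Az].
  have zj : open_side s j (point s j z.1) by apply/open_sideP; exists z.1.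
  by move: ji; rewrite (open_side_inj zj Az) eqxx.
rewrite (_ : andreev_coord s i0 = (abscissa s i0 @` andreev_set T s) `*` setT).
  apply: measurableX => //; apply: is_interval_measurable.
  apply/connected_intervalP; apply: connected_continuous_connected.
    exact: andreev_set_connected.
  by apply: continuous_subspaceT; exact: abscissa_continuous.
apply/seteqP; split => [z [zI Az]|[r y] [[x Ax xE] _]].
  by split => //; exists (point s i0 z.1) => //; exact: abscissa_point.
have [r' r'I xr'] := (open_sideP s i0 x).1 (Ai0 _ _ Ax).
move: xE; rewrite /= xr' abscissa_point => <-; split => //=.
by rewrite -xr'.
Qed.

Definition arrival_preimage s j E : set (R * R) :=
  coord_dom s j `&` [set z | E (arrival s j z)].

Lemma arrival_preimage_andreev s j E : arrival_preimage s j E `&` andreev_coord s j =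
  @flip R @^-1` (coord_preimage (~~ s) j E `&` andreev_coord (~~ s) j).
Proof.
rewrite andreev_coordN; apply/seteqP; split => z.
  move=> [[zj /= Ez] Az]; have [zI Ay] := Az.
  split; last by [].
  split; first by rewrite coord_domN coord_dom_flip.
  by move: Ez; rewrite /arrival asboolT.
move=> [[zj Ez] Az]; have [zI Ay] := Az; split; last by [].
split; first by move: zj; rewrite coord_domN coord_dom_flip.
by rewrite /= /arrival asboolT.
Qed.

Lemma arrival_preimage_nonandreev s j E : arrival_preimage s j E `\` andreev_coord s j =
  coord_preimage s j E `\` andreev_coord s j.
Proof.
have nA z : coord_dom s j z -> ~ andreev_coord s j z ->
    ~ andreev_set T s (point s j z.1).
  by move=> /coord_domP[zI _] N Az; exact: N.
apply/seteqP; split => z [[zj Ez] N]; do 2 split => //.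
  by move: Ez; rewrite /= /arrival asboolF//; exact: nA.
by rewrite /= /arrival asboolF//; exact: nA.
Qed.

Lemma arrival_preimage_measurable s j E : measurable E ->
  measurable (arrival_preimage s j E).
Proof.
move=> mE; have mA := andreev_coord_measurable.
rewrite -(setUIDK (arrival_preimage s j E) (andreev_coord s j)).
rewrite arrival_preimage_andreev arrival_preimage_nonandreev.
apply: measurableU; last by apply: measurableD => //; exact: mE.
by apply: measurable_preimage_flip; apply: measurableI => //; exact: mE.
Qed.

Lemma coord_preimage_strip s j E : coord_preimage s j E `<=` strip.
Proof. by move=> z [/coord_dom_strip]. Qed.

Lemma cosint_arrival_preimage s j E : measurable E ->
  cosint (arrival_preimage s j E) =
  cosint (coord_preimage s j E `\` andreev_coord s j) +
  cosint (coord_preimage (~~ s) j E `&` andreev_coord (~~ s) j).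
Proof.
move=> mE; have mA := andreev_coord_measurable.
rewrite (@cosint_setID _ _ (andreev_coord s j)); last 3 first.
- exact: arrival_preimage_measurable.
- exact: mA.
- by move=> z [/coord_dom_strip].
rewrite (arrival_preimage_andreev s j E) (arrival_preimage_nonandreev s j E).
have mI : measurable (coord_preimage (~~ s) j E `&` andreev_coord (~~ s) j).
  by apply: measurableI; [exact: mE|exact: mA].
by rewrite (cosint_flip mI) 1?addeC// => z [/coord_preimage_strip].
Qed.

(** Arrivals at the Andreev set of one copy are counted in the other copy, with the sign of the
    angle changed; summing over the copies puts the exchanged parts back together. *)
Lemma sum_arrival_preimage j E : measurable E ->
  \sum_(s : bool) cosint (arrival_preimage s j E) =
  \sum_(s : bool) cosint (coord_preimage s j E).
Proof.
move=> mE; have mA := andreev_coord_measurable.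
rewrite !big_bool !cosint_arrival_preimage//=.
have cE s : cosint (coord_preimage s j E) =
    cosint (coord_preimage s j E `&` andreev_coord s j) +
    cosint (coord_preimage s j E `\` andreev_coord s j).
  by apply: cosint_setID; [exact: mE|exact: mA|exact: coord_preimage_strip].
have swap (a b c d : \bar R) : a + b + (c + d) = d + a + (b + c).
  by rewrite (addeC d a) (addeACA a d) (addeC d c).
by rewrite (cE true) (cE false); exact: swap.
Qed.

Lemma coord_preimage_collision s i E :
  coord_preimage s i (collision_dom T `&` collision_map T @^-1` E) =
  \bigcup_j flight_preimage s i j (arrival_preimage s j E).
Proof.
apply/seteqP; split => z.
  move=> [zi [/(collision_dom_of_coord zi)[j [z' f]] /= Ez]].
  exists j => //; exists z' => //; have [_ z'j _ _ _] := f.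
  by split => //=; rewrite -(collision_map_of_coord f).
move=> [j _ [z' f [_ /= Ez']]]; have [zi _ _ _ _] := f.
split => //; split; first by apply/(collision_dom_of_coord zi); exists j, z'.
by rewrite /= (collision_map_of_coord f).
Qed.

Lemma collision_preimage_measurable E : measurable E ->
  measurable (collision_dom T `&` collision_map T @^-1` E).
Proof.
move=> mE; suff : collision_measurable (collision_dom T `&` collision_map T @^-1` E) by [].
move=> s i; rewrite coord_preimage_collision.
apply: fin_bigcup_measurable => [|j _]; first exact: finite_finset.
by apply: flight_preimage_measurable; exact: arrival_preimage_measurable.
Qed.

End Invariance.

Theorem theorem3 (R : realType) (T : andreevBilliard R) :
  [/\ measurable (collision_dom T),
      measurable_fun (collision_dom T) (collision_map T) &
      forall E : set (collision_space T), measurable E ->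
        cosphi_measure T (collision_dom T `&` collision_map T @^-1` E) =
        cosphi_measure T E].
Proof.
split.
- have := collision_preimage_measurable (@measurableT _ (collision_space T)).
  by rewrite preimage_setT setIT.
- by move=> _ E mE; exact: collision_preimage_measurable.
move=> E mE; rewrite /cosphi_measure.
(* Flight and arrival are separated here: a flight stays in its copy, so it is balanced over the
   sides for fixed [s]; an arrival stays on the side of index [j], so it is balanced over the copies
   for fixed [j]. *)
transitivity (\sum_(s : bool) \sum_(j < nsides T)
    \int[lebesgue_measure \x lebesgue_measure]_(z in arrival_preimage s j E) (cos z.2)%:E)%E.
  apply: eq_bigr => s _.
  under eq_bigr do rewrite coord_preimage_collision.
  apply: cosint_flight_sum; first by move=> j; exact: arrival_preimage_measurable.
  by move=> j z [].
rewrite exchange_big [RHS]exchange_big; apply: eq_bigr => j _.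
exact: sum_arrival_preimage.
Qed.
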